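(* There is an absolute constant $C>0$ such that the following holds. Let $\lambda>0$. Then for any $f \in L^1(\mathbb{T})$ there exists a measurable set $E \subset \mathbb{T}$ with $|E| \leq \frac{1}{\lambda}$ such that $$\sup_{N \geq 1} \frac{1}{N} \sum_{n=1}^N \int_{\mathbb{T} \setminus E} |S_{n}f(\theta)|^2\,d\theta \le C \lambda \|f\|_1^2 .$$
   Context: $\mathbb{T}=\mathbb{R}/\mathbb{Z}$ with Lebesgue (Haar) measure of total mass $1$, and $|E|$ is the measure of $E$. For $f\in L^1(\mathbb{T})$, $\widehat{f}(j)=\int_{\mathbb{T}} f(\theta)e^{-2\pi i j\theta}\,d\theta$ and $S_nf(\theta)=\sum_{j=-n}^n \widehat{f}(j)\,e^{2\pi i j\theta}$ is the $n$-th partial sum of the Fourier series. $\|f\|_1$ is the $L^1(\mathbb{T})$ norm. The supremum is over positive integers $N$; the set $E$ may depend on $f$ and $\lambda$ but not on $N$. *)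

(* Defs.v *)
From mathcomp Require Import all_boot all_order all_algebra.
From mathcomp Require Import all_classical all_reals all_analysis.
From mathcomp Require Export complex.

Set Implicit Arguments.
Unset Strict Implicit.
Unset Printing Implicit Defensive.

Import Order.TTheory GRing.Theory Num.Theory.
Import numFieldNormedType.Exports.

Local Open Scope classical_set_scope.
Local Open Scope ring_scope.
Local Open Scope complex_scope.

(* R/Z is modelled by its fundamental domain [0, 1[ with the restriction of
   Lebesgue measure.  A function on R/Z is given by some f : R -> R[i] of which
   only the values on [0, 1[ are ever used; measurability is Borel, every class
   in L^1(R/Z) having a Borel representative. *)
Definition torus (R : realType) : set R := `[0, 1[.
Arguments torus : clear implicits.

(* R[i] carries no measurable structure in the library, so integrability and
   integrals of complex functions are taken componentwise. *)
Definition cintegrable (R : realType) (f : R -> R[i]) : Prop :=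
  lebesgue_measure.-integrable (torus R)
    (fun t => (complex.Re (f t))%:E) /\
  lebesgue_measure.-integrable (torus R)
    (fun t => (complex.Im (f t))%:E).

Definition cintegral (R : realType) (f : R -> R[i]) : R[i] :=
  (\int[lebesgue_measure]_(t in torus R) complex.Re (f t)) +i*
  (\int[lebesgue_measure]_(t in torus R) complex.Im (f t)).

Definition cabs (R : realType) (z : R[i]) : R := ComplexField.Normc.normc z.

Definition L1norm (R : realType) (f : R -> R[i]) : R :=
  \int[lebesgue_measure]_(t in torus R) cabs (f t).

(* e^{2 pi i j t} *)
Definition echar (R : realType) (j : int) (t : R) : R[i] :=
  cos (2 * pi * j%:~R * t) +i* sin (2 * pi * j%:~R * t).

Definition fourier_coef (R : realType) (f : R -> R[i]) (j : int) : R[i] :=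
  cintegral (fun t => f t * echar (- j) t).

(* k = 0, ..., 2n encodes the frequency j = k - n in [-n, n]. *)
Definition fourier_sum (R : realType) (f : R -> R[i]) (n : nat) (t : R) :
    R[i] :=
  \sum_(k < n.*2.+1)
    fourier_coef f (k%:Z - n%:Z) * echar (k%:Z - n%:Z) t.

(* Main.v *)
Require Import Defs.
From mathcomp Require Import all_boot all_order all_algebra.
From mathcomp Require Import all_classical all_reals all_analysis.
From mathcomp Require Import measurable_realfun.
From mathcomp Require Import ring lra zify.

(* Write k_e(x) = 1 / (sin^2(pi x) + e^2), a substitute for the Poisson kernel,
   and P_e(x) for the convolution of |f| with k_e over the torus.  The
   Hardy-Littlewood maximal inequality gives a set E of measure at most
   270 |f|_1 / a off which P_e <= a / e for all e > 0 simultaneously.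

   Fix N and e = 1/N.  With Q = sin(pi x) k_e(x), the Dirichlet kernel is
     D_n(x) = Q(x) sin((2n + 1) pi x) + e^2 k_e(x) D_n(x).
   For n <= N the last term contributes at most 3 e P_e to S_n f.  For the first
   one, average |S_n f|^2 over n with Fejer-type weights: the resulting double
   integral of f(t) Q(x - t) f(s) Q(x - s) against a Fejer kernel, itself
   O(k_e(t - s)), is at most O(e^2) times the integral of |f|(t) k_e(x - t) P_e(t).

   Now integrate over x off E.  The first contribution is immediate, as
   P_e <= a / e there.  For the second, every x off E satisfies
   P_e(t) <= 3 a (|sin(pi (x - t))| + e) / e^2, so P_e(t) large keeps t away from
   the complement of E, and e^2 P_e(t) times the integral of k_e(x - t) over x
   off E is O(a).  Both contributions are thus O(a |f|_1), and a is taken to be a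
   multiple of lambda |f|_1. *)

Import Order.TTheory GRing.Theory Num.Theory.
Import numFieldNormedType.Exports.

Set Implicit Arguments.
Unset Strict Implicit.
Unset Printing Implicit Defensive.

Local Open Scope classical_set_scope.
Local Open Scope ring_scope.

(** * Elementary inequalities for the kernels *)

(** Put z = pi y / 2, which lies in [0, pi / 4]. The mean value theorem gives sin z >= z cos z, so
    sin(2 z) >= 2 z cos^2 z. As cos(2 z) >= 0, 2 cos^2 z >= 1, and what remains is z >= y, that is,
    pi >= 2. *)
Lemma le_sin_pi (R : realType) (y : R) : 0 <= y <= 1 / 2 -> y <= sin (pi * y).
Proof.
move=> /andP[y0 y1]; have p2 : 2 <= pi :> R := pi_ge2 R.
move: y0; rewrite le_eqVlt => /predU1P[<-|y0]; first by rewrite mulr0 sin0.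
set z := pi * y / 2.
have z0 : 0 < z by rewrite /z; nra.
have zp : z <= pi / 4 by rewrite /z; nra.
have [c] : exists2 c, c \in `]0, z[ & sin z - sin 0 = cos c * (z - 0) :> R.
  apply: MVT => //; exact/continuous_subspaceT/continuous_sin.
rewrite in_itv/= sin0 !subr0 => /andP[c0 cz] sz.
have cc : cos z <= cos c.
  by apply/ltW; rewrite ltr_cos// in_itv/=; lra.
have cz0 : 0 <= cos z by apply: cos_ge0_pihalf; lra.
have : sin (pi * y) = sin (z *+ 2).
  by congr sin; rewrite /z; field.
rewrite sin_mulr2n => ->.
have c2 : 0 <= cos (z *+ 2) by apply: cos_ge0_pihalf; lra.
rewrite cos_mulr2n in c2.
have : z * cos z <= sin z by rewrite sz mulrC ler_pM2r.
rewrite -(ler_pM2l y0) in p2.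
rewrite /z in c2 z0 zp *; nra.
Qed.

(* Comparable to the Poisson kernel of the disc at distance [e] from the circle,
   up to the factor [e]. *)
Definition poisson (R : realType) (e x : R) : R :=
  (sin (pi * x) ^+ 2 + e ^+ 2)^-1.

Lemma poisson_den_gt0 (R : realType) (e x : R) : 0 < e ->
  0 < sin (pi * x) ^+ 2 + e ^+ 2.
Proof. by move=> e0; rewrite ltr_wpDl ?sqr_ge0 ?exprn_gt0. Qed.

Lemma poisson_gt0 (R : realType) (e x : R) : 0 < e -> 0 < poisson e x.
Proof. by move=> e0; rewrite invr_gt0 poisson_den_gt0. Qed.

Lemma poisson_le (R : realType) (e x : R) : 0 < e -> poisson e x <= (e ^+ 2)^-1.
Proof.
move=> e0; rewrite lef_pV2 ?posrE ?exprn_gt0 ?poisson_den_gt0//.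
by rewrite lerDr sqr_ge0.
Qed.

Lemma poissonC (R : realType) (e x y : R) : poisson e (x - y) = poisson e (y - x).
Proof. by rewrite /poisson -(opprB y x) mulrN sinN sqrrN. Qed.

(** Counterpart of [poisson] on the line: it has an explicit antiderivative, and it decays away from
    0, as the comparison with a maximal function requires. *)
Definition cauchy_kernel (R : realType) (e x : R) : R := (x ^+ 2 + e ^+ 2)^-1.

Lemma cauchy_kernel_gt0 (R : realType) (e x : R) : 0 < e -> 0 < cauchy_kernel e x.
Proof. by move=> e0; rewrite invr_gt0 ltr_wpDl ?sqr_ge0 ?exprn_gt0. Qed.

(** One of x - 1, x, x + 1 has absolute value at most 1/2. Since sin^2(pi x) has period 1,
    [le_sin_pi] at that point bounds it below by the square of the point, and the other two kernels
    are positive. *)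
Lemma poisson_le_cauchy (R : realType) (e x : R) : 0 < e -> -1 < x < 1 ->
  poisson e x <=
  cauchy_kernel e (x - 1) + cauchy_kernel e x + cauchy_kernel e (x + 1).
Proof.
move=> e0 /andP[x1 x2].
have k0 y : 0 <= cauchy_kernel e y by exact/ltW/cauchy_kernel_gt0.
have le y z : 0 <= y <= 1/2 -> z ^+ 2 = y ^+ 2 ->
   sin (pi * x) ^+ 2 = sin (pi * y) ^+ 2 -> poisson e x <= cauchy_kernel e z.
  move=> y2 zy sxy.
  rewrite /poisson /cauchy_kernel lef_pV2 ?posrE ?poisson_den_gt0//; last first.
    by rewrite ltr_wpDl ?sqr_ge0 ?exprn_gt0.
  rewrite lerD2r sxy zy ler_sqr ?nnegrE; first exact: le_sin_pi.
    by case/andP: y2.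
  by apply: le_trans (le_sin_pi y2); case/andP: y2.
have sD y : sin (pi * (y + 1)) ^+ 2 = sin (pi * y) ^+ 2.
  by rewrite mulrDr mulr1 sinDpi sqrrN.
have sN y : sin (pi * - y) ^+ 2 = sin (pi * y) ^+ 2.
  by rewrite mulrN sinN sqrrN.
have k1 := k0 (x - 1); have k2 := k0 x; have k3 := k0 (x + 1).
have [h|h] := lerP x (- (1 / 2)).
  have := @le (x + 1) (x + 1) _ (erefl _); rewrite sD => /(_ _ (erefl _)).
  by move=> /(_ ltac:(lra)) kk; lra.
have [h2|h2] := lerP x 0.
  have := @le (- x) x _ _; rewrite sN sqrrN => /(_ _ (erefl _) (erefl _)).
  by move=> /(_ ltac:(lra)) kk; lra.
have [h3|h3] := lerP x (1 / 2).
  have := @le x x _ (erefl _) (erefl _).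
  by move=> /(_ ltac:(lra)) kk; lra.
have kk : poisson e x <= cauchy_kernel e (x - 1).
  apply: (le (1 - x)); first lra.
    by rewrite -sqrrN opprB.
  by rewrite -[in RHS]opprB sN -{1}(subrK 1 x) sD.
lra.
Qed.

(** Triangle inequality for the chordal distance |sin(pi (x - y))| on R/Z. *)
Lemma abs_sin_sub (R : realType) (x y z : R) :
  `|sin (pi * (x - z))| <= `|sin (pi * (x - y))| + `|sin (pi * (y - z))|.
Proof.
have -> : pi * (x - z) = pi * (x - y) + pi * (y - z) by ring.
rewrite sinD (le_trans (ler_normD _ _))// lerD// normrM.
  by rewrite ler_piMr// ler_norml cos_geN1 cos_le1.
by rewrite ler_piMl// ler_norml cos_geN1 cos_le1.
Qed.

(** Moves the centre from y to x at the price of widening the kernel to h. With r, u, v the chordal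
    distances of (x, y), (y, z), (x, z), one has v^2 <= 2 r^2 + 2 u^2, and r <= h, e <= h give e^2
    (v^2 + h^2) <= 3 h^2 (u^2 + e^2). *)
Lemma poisson_recenter (R : realType) (e x y z : R) : 0 < e ->
  let h := `|sin (pi * (x - y))| + e in
  poisson e (y - z) <= 3 * (h ^+ 2 / e ^+ 2) * poisson h (x - z).
Proof.
move=> e0; set h := _ + e; rewrite /=; have := abs_sin_sub x y z.
rewrite /poisson.
have -> : sin (pi * (y - z)) ^+ 2 = `|sin (pi * (y - z))| ^+ 2.
  by rewrite real_normK ?num_real.
have -> : sin (pi * (x - z)) ^+ 2 = `|sin (pi * (x - z))| ^+ 2.
  by rewrite real_normK ?num_real.
have h0 : 0 <= `|sin (pi * (x - y))| by [].
have u0 : 0 <= `|sin (pi * (y - z))| by [].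
have v0 : 0 <= `|sin (pi * (x - z))| by [].
rewrite {}/h; move: h0 u0 v0.
move: `|sin (pi * (x - y))| `|sin (pi * (y - z))| `|sin (pi * (x - z))| => r u v.
move=> r0 u0 v0 vru.
have e20 : 0 < e ^+ 2 by rewrite exprn_gt0.
have d1 : 0 < u ^+ 2 + e ^+ 2 by rewrite ltr_wpDl ?sqr_ge0.
have re : 0 < (r + e) ^+ 2 by rewrite exprn_gt0// ltr_wpDl.
have d2 : 0 < v ^+ 2 + (r + e) ^+ 2 by rewrite ltr_wpDl ?sqr_ge0.
rewrite ler_pdivlMr// ler_pdivrMl// [leRHS]mulrA mulrCA mulrA.
rewrite ler_pdivlMr//.
have v2 : v ^+ 2 <= 2 * r ^+ 2 + 2 * u ^+ 2.
  rewrite (@le_trans _ _ ((r + u) ^+ 2))//.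
    by rewrite ler_sqr ?nnegrE// addr_ge0.
  by have := sqr_ge0 (r - u); nra.
have r2 : r ^+ 2 <= (r + e) ^+ 2 by rewrite ler_sqr ?nnegrE; lra.
have e2 : e ^+ 2 <= (r + e) ^+ 2 by rewrite ler_sqr ?nnegrE; lra.
have u2 := sqr_ge0 u.
have : u ^+ 2 * e ^+ 2 <= u ^+ 2 * (r + e) ^+ 2 by rewrite ler_wpM2l.
move: (u ^+ 2) (e ^+ 2) ((r + e) ^+ 2) (r ^+ 2) (v ^+ 2)
  v2 r2 e2 u2 d1 d2 e20 re => U E H A V *; nra.
Qed.

(** * Closed forms and bounds for sums of cosines and sines *)

(** The sum telescopes: 2 sin(pi x) cos(2 pi j x) is sin((2j + 1) pi x) - sin((2j - 1) pi x). *)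
Lemma sin_dirichlet (R : realType) (n : nat) (x : R) :
  sin (pi * x) * \sum_(k < n.*2.+1) cos (2 * pi * (k%:Z - n%:Z)%:~R * x)
  = sin ((2 * n%:R + 1) * (pi * x)).
Proof.
pose f (k : nat) : R := sin ((2 * k%:R - 2 * n%:R - 1) * (pi * x)) / 2.
transitivity (\sum_(0 <= k < n.*2.+1) (f k.+1 - f k)).
  rewrite mulr_sumr big_mkord; apply: eq_bigr => k _.
  rewrite /f -mulrBl rmorphB/= -!pmulrn -(natr1 k).
  have -> : (2 * (k%:R + 1) - 2 * n%:R - 1) * (pi * x)
     = 2 * pi * (k%:R - n%:R) * x + pi * x by ring.
  have -> : (2 * k%:R - 2 * n%:R - 1) * (pi * x)
     = 2 * pi * (k%:R - n%:R) * x - pi * x by ring.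
  by rewrite sinB sinD; field.
rewrite telescope_sumr// /f.
have -> : (2 * (n.*2.+1)%:R - 2 * n%:R - 1) * (pi * x) = (2 * n%:R + 1) * (pi * x).
  by rewrite -(natr1 n.*2) -mul2n natrM; ring.
have -> : (2 * 0%:R - 2 * n%:R - 1) * (pi * x) = - ((2 * n%:R + 1) * (pi * x)).
  by rewrite mulr0n; ring.
by rewrite sinN; field.
Qed.

(** Reversing the index sends the frequency j to -j. This cancellation makes the Dirichlet kernel
    real, so that the real and imaginary parts of [f] can be treated apart. *)
Lemma sum_sin_odd (R : realType) (n : nat) (x : R) :
  \sum_(k < n.*2.+1) sin (2 * pi * (k%:Z - n%:Z)%:~R * x) = 0.
Proof.
set S := LHS; suff : S = - S by lra.
rewrite {1}/S (reindex_inj rev_ord_inj)/= -sumrN; apply: eq_bigr => k _.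
rewrite -sinN -mulNr -mulrN; congr (sin (_ * _ * _)).
rewrite subSS -rmorphN/=; congr (_%:~R).
by have := ltn_ord k; lia.
Qed.

(** Here S is the squared modulus of the sum of e^{2 pi i j y} over j < m, a Fejer kernel up to
    normalisation. The first bound comes from telescoping both sums after multiplication by sin(pi
    y), the second from bounding every term by 1. *)
Lemma sum_cos_sin_sqr_le (R : realType) (m : nat) (y : R) :
  let S := (\sum_(j < m) cos (2 * j%:R * (pi * y))) ^+ 2 +
           (\sum_(j < m) sin (2 * j%:R * (pi * y))) ^+ 2 in
  sin (pi * y) ^+ 2 * S <= 2 /\ S <= 2 * m%:R ^+ 2.
Proof.
set C := \sum_(j < m) cos _; set D := \sum_(j < m) sin _ => S; split.
  pose f (k : nat) : R := sin ((2 * k%:R - 1) * (pi * y)) / 2.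
  pose g (k : nat) : R := - cos ((2 * k%:R - 1) * (pi * y)) / 2.
  have Cf : sin (pi * y) * C = f m - f 0%N.
    rewrite -(telescope_sumr _ (leq0n m)) mulr_sumr big_mkord; apply: eq_bigr => k _.
    rewrite /f -mulrBl -(natr1 k).
    have -> : (2 * (k%:R + 1) - 1) * (pi * y) = 2 * k%:R * (pi * y) + pi * y by ring.
    have -> : (2 * k%:R - 1) * (pi * y) = 2 * k%:R * (pi * y) - pi * y by ring.
    by rewrite sinB sinD; field.
  have Dg : sin (pi * y) * D = g m - g 0%N.
    rewrite -(telescope_sumr _ (leq0n m)) mulr_sumr big_mkord; apply: eq_bigr => k _.
    rewrite /g -mulrBl -(natr1 k).
    have -> : (2 * (k%:R + 1) - 1) * (pi * y) = 2 * k%:R * (pi * y) + pi * y by ring.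
    have -> : (2 * k%:R - 1) * (pi * y) = 2 * k%:R * (pi * y) - pi * y by ring.
    by rewrite cosB cosD; field.
  rewrite /S mulrDr -!exprMn Cf Dg /f /g.
  set a := sin _; set b := sin _; set c := cos _; set d := cos _.
  have h1 : c ^+ 2 + a ^+ 2 = 1 by exact: cos2Dsin2.
  have h2 : d ^+ 2 + b ^+ 2 = 1 by exact: cos2Dsin2.
  have := sqr_ge0 (a + b); have := sqr_ge0 (c + d); nra.
have bnd (u : R -> R) : (forall x, `|u x| <= 1) ->
    (\sum_(j < m) u (2 * j%:R * (pi * y))) ^+ 2 <= m%:R ^+ 2.
  move=> u1; rewrite -real_normK ?num_real// ler_sqr ?nnegrE//.
  rewrite (le_trans (ler_norm_sum _ _ _))//.
  rewrite (le_trans (ler_sum _ (fun i _ => u1 _)))//.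
  by rewrite sumr_const card_ord.
rewrite /S mulr_natl mulr2n lerD// bnd// => x.
  by rewrite ler_norml cos_geN1 cos_le1.
by rewrite ler_norml sin_geN1 sin_le1.
Qed.

(** Real part of e^{i pi y} times the double sum of e^{2 pi i (j - k) y}, which is a squared
    modulus. *)
Lemma sum_cos_odd (R : realType) (m : nat) (y : R) :
  \sum_(j < m) \sum_(k < m) cos ((2 * (j%:R - k%:R) + 1) * (pi * y)) =
  cos (pi * y) * ((\sum_(j < m) cos (2 * j%:R * (pi * y))) ^+ 2 +
                  (\sum_(j < m) sin (2 * j%:R * (pi * y))) ^+ 2).
Proof.
set C := \sum_(j < m) cos _; set D := \sum_(j < m) sin _.
transitivity (\sum_(j < m) (
   (cos (pi * y) * C + sin (pi * y) * D) * cos (2 * j%:R * (pi * y)) +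
   (cos (pi * y) * D - sin (pi * y) * C) * sin (2 * j%:R * (pi * y)))).
  apply: eq_bigr => j _; rewrite /C /D !(mulr_sumr, mulr_suml).
  rewrite -sumrB !mulr_suml -!big_split /= mulr_suml -big_split/=.
  apply: eq_bigr => k _.
  have -> : (2 * (j%:R - k%:R) + 1) * (pi * y) =
   2 * j%:R * (pi * y) - 2 * k%:R * (pi * y) + pi * y by ring.
  by rewrite cosD sinB cosB; ring.
by rewrite big_split/= -!mulr_sumr -/C -/D; ring.
Qed.

(** With m = 2N and e = 1/N, the two bounds of [sum_cos_sin_sqr_le] give sin^2(pi y) S <= 2 and e^2
    S <= 8, whence the constant 10. *)
Lemma sum_cos_odd_le (R : realType) (N : nat) (y : R) : (0 < N)%N ->
  `|\sum_(j < N.*2) \sum_(k < N.*2) cos ((2 * (j%:R - k%:R) + 1) * (pi * y))|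
  <= 10 * poisson N%:R^-1 y.
Proof.
move=> N0; rewrite sum_cos_odd normrM.
have [+ +] := sum_cos_sin_sqr_le N.*2 y.
set S := (_ ^+ 2 + _ ^+ 2) => S1 S2.
have S0 : 0 <= S by rewrite addr_ge0 ?sqr_ge0.
have n0 : 0 < N%:R :> R by rewrite ltr0n.
rewrite (@le_trans _ _ S)//.
  by rewrite (ger0_norm S0) ler_piMl// ler_norml cos_geN1 cos_le1.
rewrite /poisson ler_pdivlMr ?poisson_den_gt0 ?invr_gt0// mulrDr mulrC.
have : S * N%:R^-1 ^+ 2 <= 8.
  rewrite exprVn ler_pdivrMr ?exprn_gt0// (le_trans S2)//.
  by rewrite -mul2n natrM exprMn; lra.
by lra.
Qed.

(** * Integrals of nonnegative functions and Tonelli's theorem *)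

(* The carrier of [lebesgue_measure] is the type generated by the half-open
   intervals; stating these facts over [R] itself lets side conditions be
   matched with the canonical measurable structure of [R]. *)
Section lebesgue_integral_on_R.
Local Open Scope ereal_scope.
Variable R : realType.
Local Notation mu := (@lebesgue_measure R).
Implicit Types (D : set R) (f g : R -> \bar R).

Lemma le_lint D f g : measurable D -> (forall x, D x -> 0 <= f x) ->
  measurable_fun D f -> measurable_fun D g -> (forall x, D x -> f x <= g x) ->
  \int[mu]_(x in D) f x <= \int[mu]_(x in D) g x.
Proof. by move=> mD f0 mf mg fg; exact: ge0_le_integral. Qed.

Lemma lintD D f g : measurable D ->
  (forall x, D x -> 0 <= f x) -> measurable_fun D f ->
  (forall x, D x -> 0 <= g x) -> measurable_fun D g ->
  \int[mu]_(x in D) (f x + g x) =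
  \int[mu]_(x in D) f x + \int[mu]_(x in D) g x.
Proof. by move=> mD f0 mf g0 mg; exact: ge0_integralD. Qed.

Lemma lintZl D (k : R) f : measurable D -> (0 <= k)%R ->
  (forall x, D x -> 0 <= f x) -> measurable_fun D f ->
  \int[mu]_(x in D) (k%:E * f x) = k%:E * \int[mu]_(x in D) f x.
Proof. by move=> mD k0 f0 mf; exact: ge0_integralZl. Qed.

Lemma lintZl_ereal D (k : \bar R) f : measurable D -> 0 <= k ->
  (forall x, D x -> 0 <= f x) -> measurable_fun D f ->
  \int[mu]_(x in D) (k * f x) = k * \int[mu]_(x in D) f x.
Proof. by move=> mD k0 f0 mf; exact: ge0_integralZl. Qed.

Lemma lint_indic D (f : R -> \bar R) :
  \int[mu]_(x in D) f x = \int[mu]_x (f x * (\1_D x)%:E).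
Proof. by rewrite integral_mkcond; under eq_integral do rewrite epatch_indic. Qed.

Let measurable_indic_comp D (p : R * R -> R) : measurable D ->
  measurable_fun [set: R * R] p ->
  measurable_fun [set: R * R] (fun z => (\1_D (p z))%:E : \bar R).
Proof.
move=> mD mp; apply/measurable_EFinP.
have mi : measurable_fun [set: R] (\1_D : R -> R) by exact: measurable_indic.
exact: (measurableT_comp mi mp).
Qed.

Lemma measurable_lint (D : set R) (f : R * R -> \bar R) : measurable D ->
  measurable_fun [set: R * R] f -> (forall x, 0 <= f x) ->
  measurable_fun [set: R] (fun x => \int[mu]_(y in D) f (x, y)).
Proof.
move=> mD mf f0.
rewrite (_ : (fun x => _) = (fun x => \int[mu]_y (f (x, y) * (\1_D y)%:E))); last first.
  by apply/funext => x; rewrite lint_indic.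
pose h (z : R * R) := f z * (\1_D z.2)%:E.
have mh : measurable_fun [set: R * R] h.
  by apply: emeasurable_funM => //; exact: measurable_indic_comp.
have h0 z : 0 <= h z by rewrite mule_ge0// lee_fin.
exact: (@measurable_fun_fubini_tonelli_F _ _ (measurableTypeR R) (measurableTypeR R)
  R mu h mh h0).
Qed.

(** Indicators cut both variables down to [D], which reduces the claim to Tonelli's theorem on the
    plane. *)
Lemma lint_swap (D : set R) (f : R * R -> \bar R) : measurable D ->
  measurable_fun [set: R * R] f -> (forall x, 0 <= f x) ->
  \int[mu]_(x in D) \int[mu]_(y in D) f (x, y) =
  \int[mu]_(y in D) \int[mu]_(x in D) f (x, y).
Proof.
move=> mD mf f0.
pose h (z : R * R) := f z * (\1_D z.1)%:E * (\1_D z.2)%:E.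
have mh : measurable_fun [set: R * R] h.
  apply: emeasurable_funM; last exact: measurable_indic_comp.
  by apply: emeasurable_funM => //; exact: measurable_indic_comp.
have h0 z : 0 <= h z by rewrite !mule_ge0// lee_fin.
have mf1 x : measurable_fun [set: R] (fun y => f (x, y)).
  exact: (measurableT_comp mf (pair1_measurable x)).
have mf2 y : measurable_fun [set: R] (fun x => f (x, y)).
  exact: (measurableT_comp mf (pair2_measurable y)).
have mI : measurable_fun [set: R] (fun x => (\1_D x)%:E : \bar R).
  by apply/measurable_EFinP; exact: measurable_indic.
have pull (x : R) (g : R -> \bar R) : measurable_fun [set: R] g ->
    (forall y, 0 <= g y) ->
    \int[mu]_(y in D) g y * (\1_D x)%:E =
    \int[mu]_y ((\1_D x)%:E * (g y * (\1_D y)%:E)).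
  move=> mg g0; rewrite lint_indic muleC.
  symmetry.
  have g1 y : [set: R] y -> 0 <= g y * (\1_D y)%:E.
    by move=> _; rewrite mule_ge0// lee_fin.
  have m1 := emeasurable_funM mg mI.
  have D0 : (0 <= \1_D x :> R)%R by [].
  exact: (lintZl measurableT D0 g1 m1).
transitivity (\int[mu]_x \int[mu]_y h (x, y)).
  rewrite lint_indic; apply: eq_integral => x _.
  rewrite (pull x _ (mf1 x) (fun y => f0 (x, y))).
  by apply: eq_integral => y _; rewrite /h/= muleCA muleA.
rewrite (@fubini_tonelli _ _ (measurableTypeR R) (measurableTypeR R) R mu mu h mh h0).
rewrite [RHS]lint_indic; apply: eq_integral => y _.
rewrite (pull y _ (mf2 y) (fun x => f0 (x, y))).
by apply: eq_integral => x _; rewrite /h/= muleC.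
Qed.

Lemma lint_subset_indic (D E : set R) (f : R -> \bar R) : D `<=` E ->
  \int[mu]_(x in D) f x = \int[mu]_(x in E) (f x * (\1_D x)%:E).
Proof.
move=> DE; rewrite [LHS]lint_indic [RHS]lint_indic; apply: eq_integral => x _.
rewrite -muleA -EFinM !indicE; case: (boolP (x \in D)) => [xD|_].
  by rewrite mem_set ?mulr1//; apply: DE; rewrite -inE.
by rewrite mul0r.
Qed.

End lebesgue_integral_on_R.

(** * Kernel integrals over the torus, and the exceptional set *)

Lemma measurable_torus (R : realType) : measurable (torus R : set R).
Proof. exact: measurable_itv. Qed.

Lemma continuous_cauchy_kernel (R : realType) (e c : R) : 0 < e ->
  continuous (fun x : R => cauchy_kernel e (x - c)).
Proof.
move=> e0 x; apply: cvgV.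
  by rewrite gt_eqF// ltr_wpDl ?sqr_ge0 ?exprn_gt0.
apply: cvgD; last exact: cvg_cst.
have h : (x0 - c) @[x0 --> x] --> x - c by apply: cvgB => //; exact: cvg_cst.
exact: cvgM.
Qed.

(** The antiderivative atan((x - c) / e) / e takes values in an interval of length pi / e. *)
Lemma integral_cauchy_kernel_le (R : realType) (e c : R) : 0 < e ->
  (\int[lebesgue_measure]_(x in torus R) (cauchy_kernel e (x - c))%:E
   <= (pi / e)%:E)%E.
Proof.
move=> e0; have ne : e != 0 by rewrite gt_eqF.
have ck := @continuous_cauchy_kernel R e c e0.
pose F (x : R) : R := atan ((x - c) / e) / e.
have dF (x : R) : is_derive x 1 F (cauchy_kernel e (x - c)).
  rewrite /F /cauchy_kernel.
  have d0 : (x - c) ^+ 2 + e ^+ 2 != 0.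
    by rewrite gt_eqF// ltr_wpDl ?sqr_ge0 ?exprn_gt0.
  have -> : (fun x : R => atan ((x - c) / e) / e) =
      (e^-1 \*: (atan \o (e^-1 \*: (fun x : R => x - c) : R -> R))).
    by apply/funext => y /=; rewrite /GRing.scale/= ![_ / e]mulrC.
  apply: is_derive_eq.
  change (e^-1 * ((1 + (e^-1 * (x - c)) ^+ 2)^-1 * (e^-1 * (1 - 0))) =
    ((x - c) ^+ 2 + e ^+ 2)^-1).
  by field; rewrite ne d0.
rewrite (@le_trans _ _ (\int[lebesgue_measure]_(x in `[0%R, 1%R])
    (cauchy_kernel e (x - c))%:E)%E)//.
  apply: ge0_subset_integral => //.
  - exact: measurable_torus.
  - apply: measurableT_comp => //; apply: measurable_funTS; exact: (continuous_measurable_fun ck).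
  - by move=> x _; rewrite lee_fin ltW// cauchy_kernel_gt0.
  - by apply: subset_itvl; rewrite bnd_simp.
rewrite (@continuous_FTC2 _ _ F)//.
- rewrite -EFinB lee_fin -mulrBl ler_pM2r ?invr_gt0//.
  have := @atan_ltpi2 R ((1 - c) / e); have := @atan_gtNpi2 R ((0 - c) / e); lra.
- exact: continuous_subspaceT.
- split.
  + by move=> x _; exact: ex_derive.
  + apply: cvg_at_right_filter; apply: differentiable_continuous.
    by apply/derivable1_diffP; exact: ex_derive.
  + apply: cvg_at_left_filter; apply: differentiable_continuous.
    by apply/derivable1_diffP; exact: ex_derive.
- by move=> x _; rewrite derive1E derive_val.
Qed.

(** By uniqueness of Lebesgue measure: its image under the shift has the same value on half-open
    intervals. *)
Lemma lebesgue_measure_shift (R : realType) (a : R) (A : set R) :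
  measurable A -> lebesgue_measure [set x | A (x + a)] = lebesgue_measure A.
Proof.
move=> mA.
have ms : measurable_fun [set: R] (fun x : R => x + a) by exact: measurable_funD.
rewrite [RHS](@lebesgue_measure_unique R (pushforward lebesgue_measure
  ((fun x => x + a) : measurableTypeR R -> measurableTypeR R)))//.
move=> _ [[b c] _ <-]; rewrite /pushforward/=.
transitivity (lebesgue_measure (`]b - a, c - a]%classic : set R)).
  by rewrite !lebesgue_measure_itv/= !lte_fin ltrD2r -!EFinB opprB addrA subrK.
congr (lebesgue_measure _).
by apply/seteqP; split => x /=; rewrite !in_itv/= ltrBlDr lerBrDr.
Qed.

(** Dyadic decomposition around x. A ball of radius s carries mass at most 2 s a. On the innermost
    ball the kernel is at most e^-2, which gives 2 a / e; on the shell between 2^K e and 2^(K+1) e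
    it is at most (2^K e)^-2, which gives 4 a / (2^K e). The sum stays below (2 + 8) a / e. *)
Lemma integral_cauchy_kernel_HL (R : realType) (f : R -> R) (x a e : R) (K : nat) :
  locally_integrable setT f -> (HL_maximal f x <= a%:E)%E -> 0 < e ->
  (\int[lebesgue_measure]_(t in ball x (2 ^+ K * e))
     (`|f t| * cauchy_kernel e (x - t))%:E <= (10 * a / e)%:E)%E.
Proof.
move=> lf ha e0.
have [mf _ _] := lf.
have a0 : 0 <= a.
  by rewrite -lee_fin (le_trans _ ha)// HL_maximalT_ge0.
have mass (s : R) : 0 < s ->
    (\int[lebesgue_measure]_(t in ball x s) `|f t|%:E <= (2 * s * a)%:E)%E.
  move=> s0; have : (iavg f (ball x s) <= a%:E)%E.
    apply: le_trans ha; apply: ereal_sup_ubound; exists s => //.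
    by rewrite /= in_itv/= s0.
  rewrite /iavg lebesgue_measure_ball; last exact: ltW.
  rewrite inver.
  have s20 : 0 < s *+ 2 by rewrite pmulrn_lgt0.
  rewrite gt_eqF// lee_pdivrMl// => h; apply: (le_trans h).
  by rewrite -EFinM lee_fin mulr_natl.
have mg : measurable_fun [set: R] (fun t => (`|f t| * cauchy_kernel e (x - t))%:E).
  apply/measurable_EFinP; apply: measurable_funM; first exact: measurableT_comp.
  rewrite (_ : (fun _ => _) = fun t => cauchy_kernel e (t - x)); last first.
    by apply/funext => t; rewrite /cauchy_kernel -sqrrN opprB.
  exact: (continuous_measurable_fun (continuous_cauchy_kernel e0)).
have g0 t : (0 <= (`|f t| * cauchy_kernel e (x - t))%:E)%E.
  by rewrite lee_fin mulr_ge0// ltW// cauchy_kernel_gt0.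
have far (s : R) (D : set R) : 0 < s -> measurable D ->
   (forall t, D t -> s ^+ 2 <= (x - t) ^+ 2 + e ^+ 2) -> forall b, 0 < b -> D `<=` ball x b ->
   (\int[lebesgue_measure]_(t in D) (`|f t| * cauchy_kernel e (x - t))%:E
    <= (2 * b * a / s ^+ 2)%:E)%E.
  move=> s0 mD sD b b0 Db.
  have s20 : 0 < s ^+ 2 by rewrite exprn_gt0.
  have mn : measurable_fun [set: R] (fun t => `|f t|%:E).
    by apply/measurable_EFinP; exact: measurableT_comp.
  apply: (@le_trans _ _ (\int[lebesgue_measure]_(t in D) ((s ^+ 2)^-1%:E * `|f t|%:E))%E).
    apply: ge0_le_integral => //.
    - exact: measurable_funTS.
    - by apply: measurable_funTS; apply: measurable_funeM.
    - move=> t Dt; rewrite -EFinM lee_fin mulrC ler_wpM2r//.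
      rewrite lef_pV2 ?posrE//; first exact: sD.
      by rewrite (lt_le_trans s20)// sD.
  rewrite ge0_integralZl//; [|exact: measurable_funTS|by rewrite lee_fin invr_ge0 ltW].
  rewrite [X in (_ <= X%:E)%E]mulrC EFinM lee_wpmul2l//.
    by rewrite lee_fin invr_ge0 ltW.
  apply: le_trans (mass _ b0); apply: ge0_subset_integral => //.
  - exact: measurable_ball.
  - exact: measurable_funTS.
(* Keeping the geometric remainder 8 / 2^K lets the induction close with equality. *)
suff : (\int[lebesgue_measure]_(t in ball x (2 ^+ K * e))
     (`|f t| * cauchy_kernel e (x - t))%:E <= ((10 - 8 / 2 ^+ K) * a / e)%:E)%E.
  move=> /le_trans; apply; rewrite lee_fin ler_wpM2r ?invr_ge0 ?(ltW e0)//.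
  by rewrite ler_wpM2r// gerBl divr_ge0// exprn_ge0.
elim: K => [|K IH].
  rewrite expr0 mul1r divr1 (le_trans (far e _ e0 _ _ e e0 _))//.
  - exact: measurable_ball.
  - by move=> t _; rewrite lerDr sqr_ge0.
  by rewrite lee_fin; rewrite le_eqVlt; apply/orP; left; apply/eqP; field; rewrite gt_eqF.
have K0 : 0 < 2 ^+ K :> R by rewrite exprn_gt0.
have sub : ball x (2 ^+ K * e) `<=` ball x (2 ^+ K.+1 * e).
  by apply: le_ball; rewrite ler_pM2r// exprS; lra.
rewrite -(setDUK sub) ge0_integral_setU//=.
- rewrite (le_trans (leeD IH (far (2 ^+ K * e) _ _ _ _ (2 ^+ K.+1 * e) _ _)))//.
  + by rewrite mulr_gt0.
  + by apply: measurableD; exact: measurable_ball.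
  + move=> t [_ /negP]; rewrite -leNgt => h.
    rewrite -[(x - t) ^+ 2]real_normK ?num_real// ler_wpDr ?sqr_ge0//.
    by rewrite ler_sqr ?nnegrE// mulr_ge0// ltW.
  + by rewrite mulr_gt0// exprn_gt0.
  rewrite -EFinD lee_fin exprS le_eqVlt; apply/orP; left; apply/eqP; field.
  by rewrite !gt_eqF.
- exact: measurable_ball.
- by apply: measurableD; exact: measurable_ball.
- exact: measurable_funTS.
- by apply/disj_setPS => t [/= ? [_ ]].
Qed.

Lemma measurable_poisson (R : realType) (e : R) : 0 < e ->
  measurable_fun [set: R] (poisson e : R -> R).
Proof.
move=> e0; apply: continuous_measurable_fun => x.
apply: cvgV; first by rewrite gt_eqF// poisson_den_gt0.
apply: cvgD; last exact: cvg_cst.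
have h : sin (pi * y) @[y --> x] --> sin (pi * x).
  apply: continuous_comp; last exact: continuous_sin.
  by apply: cvgM; [exact: cvg_cst|exact: cvg_id].
exact: cvgM.
Qed.

Lemma measurable_cauchy_kernel (R : realType) (e : R) : 0 < e ->
  measurable_fun [set: R] (cauchy_kernel e : R -> R).
Proof.
move=> e0; rewrite (_ : cauchy_kernel e = fun x => cauchy_kernel e (x - 0)).
  exact: (continuous_measurable_fun (continuous_cauchy_kernel e0)).
by apply/funext => x; rewrite subr0.
Qed.

Lemma torus_subr (R : realType) (x y : R) :
  torus R x -> torus R y -> -1 < x - y < 1.
Proof. by rewrite /torus/= !in_itv/= => /andP[? ?] /andP[? ?]; lra. Qed.

(** Three translates of the Cauchy kernel, each of mass at most pi / e, and pi < 4. *)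
Lemma integral_poisson_le (R : realType) (e c : R) : 0 < e -> torus R c ->
  (\int[lebesgue_measure]_(x in torus R) (poisson e (x - c))%:E
   <= (12 / e)%:E)%E.
Proof.
move=> e0 cT.
have mk (d : R) : measurable_fun (torus R) (fun x : R => (cauchy_kernel e (x - d))%:E).
  apply/measurable_EFinP; apply: measurable_funTS.
  exact: (continuous_measurable_fun (continuous_cauchy_kernel e0)).
have k0 (d x : R) : torus R x -> (0 <= (cauchy_kernel e (x - d))%:E)%E.
  by move=> _; rewrite lee_fin ltW// cauchy_kernel_gt0.
have mT := @measurable_torus R.
have mkD := emeasurable_funD (mk (c + 1)) (mk c).
apply: (@le_trans _ _ (\int[lebesgue_measure]_(x in torus R)
   ((cauchy_kernel e (x - (c + 1)))%:E + (cauchy_kernel e (x - c))%:E +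
    (cauchy_kernel e (x - (c - 1)))%:E))%E).
  apply: le_lint => //.
  - by move=> x _; rewrite lee_fin ltW// poisson_gt0.
  - apply/measurable_EFinP; apply: measurable_funTS.
    by apply: (measurableT_comp (measurable_poisson e0)); exact: measurable_funB.
  - exact: (emeasurable_funD mkD (mk (c - 1))).
  - move=> x xT; rewrite -!EFinD lee_fin opprD opprB !addrA [x + 1 - c]addrAC.
    exact/poisson_le_cauchy/torus_subr.
rewrite lintD//; [|by move=> x xT; rewrite adde_ge0// k0|exact: k0].
rewrite lintD//; [|exact: k0|exact: k0].
have ck := fun d => @integral_cauchy_kernel_le R e d e0.
rewrite (le_trans (leeD (leeD (ck _) (ck _)) (ck _)))//.
rewrite -!EFinD lee_fin -!mulrDl ler_pM2r ?invr_gt0//.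
have := @pihalf_lt2 R; lra.
Qed.

Lemma lebesgue_measureU3_le (R : realType) (X Y Z : set R) (m : \bar R) :
  measurable X -> measurable Y -> measurable Z ->
  (lebesgue_measure X <= m)%E -> (lebesgue_measure Y <= m)%E ->
  (lebesgue_measure Z <= m)%E -> (lebesgue_measure (X `|` Y `|` Z) <= m + m + m)%E.
Proof.
move=> mX mY mZ Xm Ym Zm.
have U2 (A B : set R) : measurable A -> measurable B ->
    (lebesgue_measure (A `|` B) <= lebesgue_measure A + lebesgue_measure B)%E.
  by move=> mA mB; exact: measureU2.
rewrite (le_trans (U2 _ _ (measurableU _ _ mX mY) mZ))// leeD//.
by rewrite (le_trans (U2 _ _ mX mY))// leeD.
Qed.

(* 270 = 3 * 3 * 30: three translates to account for periodicity, the constant 3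
   of the maximal inequality, and [b = a / 30]. *)
Lemma exceptional_set (R : realType) (f : R -> R) (a : R) :
  lebesgue_measure.-integrable (torus R) (EFin \o f) -> 0 < a ->
  exists E : set R, [/\ measurable E, E `<=` torus R,
    (lebesgue_measure E <=
      (270 / a)%:E * \int[lebesgue_measure]_(t in torus R) `|f t|%:E)%E &
    forall x e, (torus R `\` E) x -> 0 < e ->
      (\int[lebesgue_measure]_(t in torus R) (`|f t| * poisson e (x - t))%:E
       <= (a / e)%:E)%E].
Proof.
move=> fi a0; set b := a / 30; have b0 : 0 < b by rewrite divr_gt0.
have mT := @measurable_torus R.
(* The maximal function lives on the line, so [f] is cut off to one period; evaluating at x - 1, x
   and x + 1 recovers the neighbouring periods. *)
pose g := f \_ (torus R).
have lg : locally_integrable [set: R] g by exact: integrable_locally_restrict.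
pose A : set R := [set x | (b%:E < HL_maximal g x)%E].
have mA : measurable A.
  rewrite -[A]setTI; apply: emeasurable_fun_o_infty => //.
  exact: measurable_HL_maximal.
pose S (c : R) : set R := [set x | A (x + c)].
have mS c : measurable (S c).
  rewrite -[S c]setTI.
  have : measurable_fun [set: R] (fun x : R => x + c) by exact: measurable_funD.
  by move=> /(_ measurableT _ mA).
have muA : (lebesgue_measure A <= (90 / a)%:E *
     \int[lebesgue_measure]_(t in torus R) `|f t|%:E)%E.
  rewrite (le_trans (maximal_inequality lg b0))//.
  rewrite (_ : 3 / b = 90 / a); last by rewrite /b; field; rewrite gt_eqF.
  rewrite lee_wpmul2l//; first by rewrite lee_fin divr_ge0// ltW.
  rewrite [leRHS]integral_mkcond le_eqVlt; apply/orP; left; apply/eqP.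
  apply: eq_integral => t _; rewrite /g !patchE; case: ifP => //.
  by move=> _ /=; rewrite normr0.
have muS c : lebesgue_measure (S c) = lebesgue_measure A by exact: lebesgue_measure_shift.
have mU : measurable (S (-1) `|` S 0 `|` S 1 : set R).
  exact: (measurableU _ _ (measurableU _ _ (mS _) (mS _)) (mS _)).
exists (torus R `&` (S (-1) `|` S 0 `|` S 1)); split.
- exact: (measurableI _ _ mT mU).
- exact: subIsetl.
- apply: (@le_trans _ _ (lebesgue_measure (S (-1) `|` S 0 `|` S 1))).
    apply: le_measure; rewrite ?inE; last exact: subIsetr.
      exact: (measurableI _ _ mT mU).
    exact: mU.
  have muS' c : (lebesgue_measure (S c) <= (90 / a)%:E *
     \int[lebesgue_measure]_(t in torus R) `|f t|%:E)%E by rewrite muS.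
  apply: (le_trans (lebesgue_measureU3_le (mS _) (mS _) (mS _) (muS' _) (muS' _) (muS' _))).
  rewrite -!ge0_muleDl ?lee_fin ?divr_ge0 ?(ltW a0)//; last 1 first.
    by rewrite addr_ge0// divr_ge0// ltW.
  by rewrite -!EFinD -!mulrDl -!natrD.
move=> x e [xT nE] e0.
have HLc c : ~ S c x -> (HL_maximal g (x + c) <= b%:E)%E.
  by move=> nS; rewrite leNgt; apply/negP.
have H1 : (HL_maximal g (x + 1) <= b%:E)%E.
  by apply: HLc => Sx; apply: nE; split => //; right.
have H0 : (HL_maximal g (x + 0) <= b%:E)%E.
  by apply: HLc => Sx; apply: nE; split => //; left; right.
have HN : (HL_maximal g (x + -1) <= b%:E)%E.
  by apply: HLc => Sx; apply: nE; split => //; left; left.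
(* For x, t in the torus and |c| <= 1, |x + c - t| < 2, so the ball of radius 2^K e around x + c
   covers the torus. *)
have [K K2] : exists K, 2 < 2 ^+ K * e.
  exists (Num.bound (2 / e)); rewrite -ltr_pdivrMr//.
  have := @archi_boundP R (2 / e); rewrite divr_ge0 ?ltW// => /(_ isT) /lt_trans; apply.
  by rewrite -natrX ltr_nat ltn_expl.
have mf : measurable_fun (torus R) f by apply/measurable_EFinP; exact: measurable_int fi.
have mn : measurable_fun (torus R) (fun t => `|f t|) by exact: measurableT_comp.
have mk c : measurable_fun (torus R) (fun t => (`|f t| * cauchy_kernel e (x + c - t))%:E).
  apply/measurable_EFinP; apply: measurable_funM => //; apply: measurable_funTS.
  by apply: (measurableT_comp (measurable_cauchy_kernel e0)); exact: measurable_funB.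
have k0 c t : torus R t -> (0 <= (`|f t| * cauchy_kernel e (x + c - t))%:E)%E.
  by move=> _; rewrite lee_fin mulr_ge0// ltW// cauchy_kernel_gt0.
have Ic c : -1 <= c <= 1 -> (HL_maximal g (x + c) <= b%:E)%E ->
    (\int[lebesgue_measure]_(t in torus R)
       (`|f t| * cauchy_kernel e (x + c - t))%:E <= (10 * b / e)%:E)%E.
  move=> c1 Hc; apply: le_trans (integral_cauchy_kernel_HL K lg Hc e0).
  have [mg _ _] := lg.
  apply: (@le_trans _ _ (\int[lebesgue_measure]_(t in torus R)
      (`|g t| * cauchy_kernel e (x + c - t))%:E)%E).
    rewrite le_eqVlt; apply/orP; left; apply/eqP.
    by apply: eq_integral => t tT; rewrite /g patchE tT.
  apply: ge0_subset_integral.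
  - exact: measurable_torus.
  - exact: measurable_ball.
  - apply: measurable_funTS; apply/measurable_EFinP; apply: measurable_funM.
      exact: measurableT_comp.
    by apply: (measurableT_comp (measurable_cauchy_kernel e0)); exact: measurable_funB.
  - by move=> t _; rewrite lee_fin mulr_ge0// ltW// cauchy_kernel_gt0.
  - move=> t tT; rewrite /ball/=; apply: lt_trans K2.
    by have := torus_subr xT tT; rewrite ltr_norml; lra.
apply: (@le_trans _ _ (\int[lebesgue_measure]_(t in torus R)
   ((`|f t| * cauchy_kernel e (x + -1 - t))%:E +
    (`|f t| * cauchy_kernel e (x + 0 - t))%:E +
    (`|f t| * cauchy_kernel e (x + 1 - t))%:E))%E).
  apply: le_lint => //.
  - by move=> t _; rewrite lee_fin mulr_ge0// ltW// poisson_gt0.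
  - apply/measurable_EFinP; apply: measurable_funM => //; apply: measurable_funTS.
    by apply: (measurableT_comp (measurable_poisson e0)); exact: measurable_funB.
  - exact: (emeasurable_funD (emeasurable_funD (mk _) (mk _)) (mk _)).
  - move=> t tT; rewrite -!EFinD lee_fin -!mulrDr ler_wpM2l// addr0.
    by rewrite ![x + _ - t]addrAC; exact/poisson_le_cauchy/torus_subr.
rewrite lintD//; [|by move=> t tT; rewrite adde_ge0// k0
                 |exact: (emeasurable_funD (mk _) (mk _))|exact: k0].
rewrite lintD//; [|exact: k0|exact: k0].
rewrite (le_trans (leeD (leeD (Ic _ _ HN) (Ic _ _ H0)) (Ic _ _ H1)))//; [lra|lra|lra|].
by rewrite -!EFinD lee_fin -!mulrDl ler_pM2r ?invr_gt0// /b; lra.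
Qed.

(** * Integrals against trigonometric functions over the torus *)

Section torus_integrals.
Variable R : realType.
Local Notation mu := (@lebesgue_measure R).
Implicit Types u v h : R -> R.

Definition tintegrable u := mu.-integrable (torus R) (EFin \o u).

Lemma tintegrable_measurable u : tintegrable u -> measurable_fun (torus R) u.
Proof. by move=> iu; apply/measurable_EFinP; exact: measurable_int iu. Qed.

Lemma tintegrableM u h (M : R) : tintegrable u -> measurable_fun [set: R] h ->
  (forall x, `|h x| <= M) -> tintegrable (fun x => u x * h x).
Proof.
move=> iu mh hM; rewrite /tintegrable.
rewrite (_ : _ \o _ = (EFin \o u) \* (EFin \o h))%E; last first.
  by apply/funext => x /=; rewrite EFinM.
apply: integrableMl => //.
- exact: measurable_torus.
- exact: measurable_funTS.
- exists M; split; first by rewrite num_real.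
  by move=> y My x _; exact: le_trans (hM x) (ltW My).
Qed.

Lemma tintegrable_sum (I : Type) (r : seq I) (F : I -> R -> R) :
  (forall i, tintegrable (F i)) -> tintegrable (fun x => \sum_(i <- r) F i x).
Proof.
move=> iF; rewrite /tintegrable.
rewrite (_ : _ \o _ = (fun x => \sum_(i <- r) (F i x)%:E))%E; last first.
  by apply/funext => x /=; rewrite sumEFin.
by apply: integrable_sum => [|i _]; [exact: measurable_torus|exact: iF].
Qed.

Lemma tintegrableD u v : tintegrable u -> tintegrable v ->
  tintegrable (fun x => u x + v x).
Proof.
move=> iu iv; rewrite /tintegrable.
rewrite (_ : _ \o _ = (EFin \o u) \+ (EFin \o v))%E; last first.
  by apply/funext => x /=; rewrite EFinD.
by apply: integrableD => //; exact: measurable_torus.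
Qed.

Lemma tintegrableMr u (c : R) : tintegrable u -> tintegrable (fun x => u x * c).
Proof.
move=> iu; apply: (@tintegrableM u (fun=> c) `|c| iu) => //.
Qed.

Lemma tintegral_sum (I : Type) (r : seq I) (F : I -> R -> R) :
  (forall i, tintegrable (F i)) ->
  \int[mu]_(x in torus R) (\sum_(i <- r) F i x) =
  \sum_(i <- r) \int[mu]_(x in torus R) F i x.
Proof.
move=> iF; elim: r => [|i r IH].
  rewrite big_nil; under eq_Rintegral do rewrite big_nil.
  by rewrite Rintegral_cst ?mul0r//; exact: measurable_torus.
rewrite big_cons -IH -RintegralD//.
- by apply: eq_Rintegral => x _; rewrite big_cons.
- exact: measurable_torus.
- exact: iF.
- exact: (tintegrable_sum r iF).
Qed.

Lemma tintegralD u v : tintegrable u -> tintegrable v ->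
  \int[mu]_(x in torus R) (u x + v x) =
  \int[mu]_(x in torus R) u x + \int[mu]_(x in torus R) v x.
Proof. by move=> iu iv; rewrite RintegralD//; exact: measurable_torus. Qed.

Lemma tintegralZr u (c : R) : tintegrable u ->
  \int[mu]_(x in torus R) (u x * c) = \int[mu]_(x in torus R) u x * c.
Proof. by move=> iu; rewrite RintegralZr//; exact: measurable_torus. Qed.

Lemma tintegral_abs_le u : tintegrable u ->
  ((`|\int[mu]_(x in torus R) u x|)%:E <=
   \int[mu]_(x in torus R) `|u x|%:E)%E.
Proof.
move=> iu; rewrite EFin_normr_Rintegral//; last exact: measurable_torus.
apply: le_abse_integral; first exact: measurable_torus.
exact: measurable_int iu.
Qed.

Lemma measurable_cosM (w c : R) :
  measurable_fun [set: R] (fun x : R => cos (w * (c - x))).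
Proof.
apply: (measurableT_comp (f := cos)).
  exact: (continuous_measurable_fun (@continuous_cos R)).
exact: (measurable_funM (measurable_cst w)
  (measurable_funB (measurable_cst c) (@measurable_id _ _ setT))).
Qed.

Lemma measurable_sinM (w c : R) :
  measurable_fun [set: R] (fun x : R => sin (w * (c - x))).
Proof.
apply: (measurableT_comp (f := sin)).
  exact: (continuous_measurable_fun (@continuous_sin R)).
exact: (measurable_funM (measurable_cst w)
  (measurable_funB (measurable_cst c) (@measurable_id _ _ setT))).
Qed.

Lemma abs_cos_le1 (x : R) : `|cos x| <= 1.
Proof. by rewrite ler_norml cos_geN1 cos_le1. Qed.

Lemma abs_sin_le1 (x : R) : `|sin x| <= 1.
Proof. by rewrite ler_norml sin_geN1 sin_le1. Qed.

Lemma tintegrable_cos u (w c : R) : tintegrable u ->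
  tintegrable (fun x => u x * cos (w * (c - x))).
Proof.
move=> iu; apply: (tintegrableM (M := 1)) => //; first exact: measurable_cosM.
by move=> x; exact: abs_cos_le1.
Qed.

Lemma tintegrable_sin u (w c : R) : tintegrable u ->
  tintegrable (fun x => u x * sin (w * (c - x))).
Proof.
move=> iu; apply: (tintegrableM (M := 1)) => //; first exact: measurable_sinM.
by move=> x; exact: abs_sin_le1.
Qed.

(** Each summand is the double integral of h(t) h(s) cos(w_i (s - t)), by the subtraction formula
    for the cosine. The sum over i is then taken inside, where absolute values and [B] apply. *)
Lemma sum_sqr_trig_integrals_le (I : Type) (r : seq I) (w : I -> R) (c : R)
    h (B : R -> R) :
  tintegrable h -> measurable_fun [set: R] h ->
  measurable_fun [set: R] B ->
  (forall y, `|\sum_(i <- r) cos (w i * y)| <= B y) ->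
  ((\sum_(i <- r) ((\int[mu]_(t in torus R) (h t * cos (w i * (c - t)))) ^+ 2 +
                  (\int[mu]_(t in torus R) (h t * sin (w i * (c - t)))) ^+ 2))%:E
  <= \int[mu]_(t in torus R) \int[mu]_(s in torus R)
       (`|h t| * `|h s| * B (s - t))%:E)%E.
Proof.
move=> ih mh mB hB.
pose C i := \int[mu]_(t in torus R) (h t * cos (w i * (c - t))).
pose S i := \int[mu]_(t in torus R) (h t * sin (w i * (c - t))).
pose G t := \int[mu]_(s in torus R) (h s * \sum_(i <- r) cos (w i * (s - t))).
have iC i t : tintegrable (fun s => h s * cos (w i * (c - s)) * cos (w i * (c - t))).
  apply: (tintegrableM (h := fun=> cos (w i * (c - t)))) => //; exact: tintegrable_cos.
have iS i t : tintegrable (fun s => h s * sin (w i * (c - s)) * sin (w i * (c - t))).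
  apply: (tintegrableM (h := fun=> sin (w i * (c - t)))) => //; exact: tintegrable_sin.
have iCS i t : tintegrable (fun s => h s * cos (w i * (s - t))).
  rewrite (_ : (fun s => _) = fun s => h s * cos (w i * (t - s))).
    exact: tintegrable_cos.
  by apply/funext => s; rewrite -cosN -mulrN opprB.
(* The subtraction formula separates s from t: [G] is a finite trigonometric sum with coefficients
   [C i] and [S i], and integrating it against [h] gives back their squares. *)
have GE t : G t = \sum_(i <- r) (C i * cos (w i * (c - t)) + S i * sin (w i * (c - t))).
  rewrite /G; under eq_Rintegral do rewrite mulr_sumr.
  rewrite tintegral_sum//; apply: eq_bigr => i _.
  rewrite /C /S -tintegralZr; last exact: tintegrable_cos.
  rewrite -tintegralZr; last exact: tintegrable_sin.
  rewrite -tintegralD//; apply: eq_Rintegral => s _.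
  have -> : w i * (s - t) = w i * (c - t) - w i * (c - s) by ring.
  by rewrite cosB; ring.
have iGi i : tintegrable (fun t => h t * cos (w i * (c - t)) * C i +
    h t * sin (w i * (c - t)) * S i).
  apply: tintegrableD; apply: tintegrableMr; first exact: tintegrable_cos.
  exact: tintegrable_sin.
have hGE : (fun t => h t * G t) = fun t => \sum_(i <- r)
    (h t * cos (w i * (c - t)) * C i + h t * sin (w i * (c - t)) * S i).
  by apply/funext => t; rewrite GE mulr_sumr; apply: eq_bigr => i _; ring.
have iG : tintegrable (fun t => h t * G t).
  by rewrite hGE; exact: tintegrable_sum.
have -> : \sum_(i <- r) (C i ^+ 2 + S i ^+ 2) = \int[mu]_(t in torus R) (h t * G t).
  rewrite hGE tintegral_sum//; apply: eq_bigr => i _.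
  rewrite tintegralD; last 2 first.
  - by apply: tintegrableMr; exact: tintegrable_cos.
  - by apply: tintegrableMr; exact: tintegrable_sin.
  rewrite tintegralZr; last exact: tintegrable_cos.
  by rewrite tintegralZr//; exact: tintegrable_sin.
rewrite (@le_trans _ _ (`|\int[mu]_(t in torus R) (h t * G t)|%:E))//.
  by rewrite lee_fin ler_norm.
apply: (le_trans (tintegral_abs_le iG)).
have B0 y : 0 <= B y by apply: le_trans (hB y).
have mn : measurable_fun [set: R] (fun t => `|h t|) by exact: measurableT_comp.
have mker : measurable_fun [set: R * R]
    (fun z => (`|h z.1| * `|h z.2| * B (z.2 - z.1))%:E).
  apply/measurable_EFinP; apply: measurable_funM.
    apply: measurable_funM.
      exact: (measurableT_comp mn measurable_fst).
    exact: (measurableT_comp mn measurable_snd).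
  apply: (measurableT_comp mB); apply: measurable_funB.
    exact: measurable_snd.
  exact: measurable_fst.
have ker0 z : (0 <= (`|h z.1| * `|h z.2| * B (z.2 - z.1))%:E)%E.
  by rewrite lee_fin !mulr_ge0.
apply: le_lint.
- exact: measurable_torus.
- by move=> t _; rewrite lee_fin.
- apply/measurable_EFinP; apply: measurableT_comp => //.
  exact: (tintegrable_measurable iG).
- apply: measurable_funTS.
  exact: (measurable_lint (@measurable_torus R) mker ker0).
move=> t _; rewrite normrM EFinM.
have mker2 : measurable_fun [set: R] (fun s => (`|h s| * B (s - t))%:E).
  apply/measurable_EFinP; apply: measurable_funM => //.
  by apply: (measurableT_comp mB); exact: measurable_funB.
rewrite (_ : (\int[mu]_(s in torus R) (`|h t| * `|h s| * B (s - t))%:E)%E =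
    (`|h t|%:E * \int[mu]_(s in torus R) (`|h s| * B (s - t))%:E)%E); last first.
  rewrite -lintZl//.
  - by apply: eq_integral => s _; rewrite -EFinM mulrA.
  - exact: measurable_torus.
  - by move=> s _; rewrite lee_fin mulr_ge0.
  - exact: measurable_funTS.
rewrite lee_wpmul2l//.
have iGs : tintegrable (fun s => h s * \sum_(i <- r) cos (w i * (s - t))).
  rewrite (_ : (fun s => _) = fun s => \sum_(i <- r) (h s * cos (w i * (s - t)))).
    exact: tintegrable_sum.
  by apply/funext => s; rewrite mulr_sumr.
apply: (le_trans (tintegral_abs_le iGs)).
apply: le_lint.
- exact: measurable_torus.
- by move=> s _; rewrite lee_fin.
- apply/measurable_EFinP; apply: measurableT_comp => //.
  exact: (tintegrable_measurable iGs).
- exact: measurable_funTS.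
- by move=> s _; rewrite lee_fin normrM ler_wpM2l.
Qed.

End torus_integrals.

(** * The split Dirichlet kernel and the pointwise bound on the quadratic means *)

(** The sum of e^{2 pi i j x} over |j| <= n, whose sine parts cancel by [sum_sin_odd]. *)
Definition dirichlet (R : realType) (n : nat) (x : R) : R :=
  \sum_(k < n.*2.+1) cos (2 * pi * (k%:Z - n%:Z)%:~R * x).

Definition dirichlet_conv (R : realType) (u : R -> R) (n : nat) (x : R) : R :=
  \int[lebesgue_measure]_(t in torus R) (u t * dirichlet n (x - t)).

(** The function P_e, valued in [\bar R] so that Tonelli's theorem applies to it directly. *)
Definition poisson_conv (R : realType) (u : R -> R) (e x : R) : \bar R :=
  (\int[lebesgue_measure]_(t in torus R) (`|u t| * poisson e (x - t))%:E)%E.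

(** The function Q. It changes sign under x -> x + 1, as does sin((2n + 1) pi x), so that their
    product has period 1. *)
Definition conjugate_poisson (R : realType) (e x : R) : R :=
  sin (pi * x) * poisson e x.

(** Multiply the kernel by 1 = (sin^2(pi x) + e^2) k_e(x) and apply [sin_dirichlet] to the sine
    part. *)
Lemma dirichlet_split (R : realType) (n : nat) (e x : R) : 0 < e ->
  dirichlet n x = conjugate_poisson e x * sin ((2 * n%:R + 1) * pi * x) +
                  dirichlet n x * (e ^+ 2 * poisson e x).
Proof.
move=> e0; rewrite -[X in sin X]mulrA -sin_dirichlet -/(dirichlet n x).
have := poisson_den_gt0 x e0; rewrite /conjugate_poisson /poisson.
by move=> d0; field; rewrite gt_eqF.
Qed.

Lemma abs_dirichlet_le (R : realType) (n : nat) (x : R) :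
  `|dirichlet n x| <= 2 * n%:R + 1.
Proof.
rewrite (le_trans (ler_norm_sum _ _ _))//.
rewrite (le_trans (ler_sum _ (fun i _ => abs_cos_le1 _)))//.
by rewrite sumr_const card_ord -(natr1 n.*2) -mul2n natrM.
Qed.

Lemma conjugate_poisson_sqr_le (R : realType) (e x : R) : 0 < e ->
  conjugate_poisson e x ^+ 2 <= poisson e x.
Proof.
move=> e0; have d0 := poisson_den_gt0 x e0.
rewrite /conjugate_poisson exprMn /poisson exprVn.
rewrite ler_pdivrMr ?exprn_gt0// (expr2 (_ + _)) mulKf ?gt_eqF//.
by rewrite lerDl sqr_ge0.
Qed.

Lemma abs_conjugate_poisson_le (R : realType) (e x : R) : 0 < e ->
  `|conjugate_poisson e x| <= (e ^+ 2)^-1.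
Proof.
move=> e0; rewrite normrM (ger0_norm (ltW (poisson_gt0 x e0))).
rewrite -[leRHS]mul1r ler_pM//; [|exact: abs_sin_le1|exact: poisson_le].
exact/ltW/poisson_gt0.
Qed.

(** From Q^2 <= k_e and the inequality of arithmetic and geometric means; it decouples the two
    variables in the double integral. *)
Lemma mul_abs_conjugate_poisson_le (R : realType) (e x y : R) : 0 < e ->
  `|conjugate_poisson e x| * `|conjugate_poisson e y| <=
  (poisson e x + poisson e y) / 2.
Proof.
move=> e0.
have := conjugate_poisson_sqr_le x e0; have := conjugate_poisson_sqr_le y e0.
rewrite -[conjugate_poisson e x ^+ 2]real_normK ?num_real//.
rewrite -[conjugate_poisson e y ^+ 2]real_normK ?num_real//.
have := sqr_ge0 (`|conjugate_poisson e x| - `|conjugate_poisson e y|); nra.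
Qed.

(* Summing over pairs [(j, k)] plays the role of Fejer weights. *)
Lemma sum_odd_freq_le (R : realType) (A : R -> R) (N : nat) :
  (forall x, 0 <= A x) ->
  N%:R * \sum_(1 <= n < N.+1) A (2 * n%:R + 1) <=
  \sum_(j < N.*2) \sum_(k < N.*2) A (2 * (j%:R - k%:R) + 1).
Proof.
move=> A0; rewrite exchange_big/=.
rewrite -(big_mkord xpredT (fun k => \sum_(j < N.*2) A (2 * (j%:R - k%:R) + 1))).
(* For each k < N, the indices j = k + n with 1 <= n <= N stay below 2N, so every n occurs N times;
   the remaining terms are nonnegative and are dropped. *)
have N2 : (N <= N.*2)%N by lia.
rewrite (big_cat_nat (leq0n N) N2)/=.
rewrite ler_wpDr//; first by apply: sumr_ge0 => k _; exact: sumr_ge0.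
rewrite -[X in X%:R * _](subn0 N) mulr_natl -sumr_const_nat.
apply: ler_sum_nat => k /andP[_ kN].
rewrite -(big_mkord xpredT (fun j => A (2 * (j%:R - k%:R) + 1))).
have k1 : (k.+1 <= (N + k).+1)%N by lia.
have k2 : ((N + k).+1 <= N.*2)%N by lia.
rewrite (big_cat_nat (leq0n k.+1) (leq_trans k1 k2))/=.
rewrite ler_wpDl//; first by apply: sumr_ge0.
rewrite (big_cat_nat k1 k2)/=.
rewrite ler_wpDr//; first by apply: sumr_ge0.
rewrite -[k.+1]add1n -addSn big_addn addnK.
by apply: ler_sum_nat => n _; rewrite natrD addrK.
Qed.

Lemma measurable_poisson_sub (R : realType) (e x : R) : 0 < e ->
  measurable_fun [set: R] (fun t => poisson e (x - t)).
Proof.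
move=> e0; apply: (measurableT_comp (measurable_poisson e0)).
exact: measurable_funB.
Qed.

Lemma measurable_dirichlet (R : realType) (n : nat) (x : R) :
  measurable_fun [set: R] (fun t => dirichlet n (x - t)).
Proof. by apply: measurable_sum => k; exact: measurable_cosM. Qed.

Section pointwise_bound.
Variables (R : realType) (u : R -> R).
Local Notation mu := (@lebesgue_measure R).
Hypotheses (um : measurable_fun [set: R] u) (iu : tintegrable u).

Let mn : measurable_fun [set: R] (fun t => `|u t|).
Proof. exact: measurableT_comp. Qed.

Lemma measurable_poisson_conv_kernel (e : R) : 0 < e ->
  measurable_fun [set: R * R] (fun z => (`|u z.2| * poisson e (z.1 - z.2))%:E).
Proof.
move=> e0; apply/measurable_EFinP; apply: measurable_funM.
  exact: (measurableT_comp mn measurable_snd).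
apply: (measurableT_comp (measurable_poisson e0)).
exact: (measurable_funB measurable_fst measurable_snd).
Qed.

Lemma poisson_conv_ge0 (e x : R) : 0 < e -> (0 <= poisson_conv u e x)%E.
Proof.
move=> e0; apply: integral_ge0 => t _.
by rewrite lee_fin mulr_ge0// ltW// poisson_gt0.
Qed.

Lemma measurable_poisson_conv (e : R) : 0 < e ->
  measurable_fun [set: R] (poisson_conv u e).
Proof.
move=> e0.
apply: (measurable_lint (@measurable_torus R) (measurable_poisson_conv_kernel e0)).
by move=> z; rewrite lee_fin mulr_ge0// ltW// poisson_gt0.
Qed.

(** [mul_abs_conjugate_poisson_le] bounds the integrand by two terms with weight 10 / 2 = 5,
    exchanged by swapping t and s. By Tonelli both have the same integral, and integrating out one
    variable produces P_e. *)
Lemma far_part_le (e x : R) (h : R -> R) : 0 < e ->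
  h = (fun t => u t * conjugate_poisson e (x - t)) ->
  (\int[mu]_(t in torus R) \int[mu]_(s in torus R)
      (`|h t| * `|h s| * (10 * poisson e (s - t)))%:E <=
   10%:E * \int[mu]_(t in torus R)
      ((`|u t| * poisson e (x - t))%:E * poisson_conv u e t))%E.
Proof.
move=> e0 hE.
have mT := @measurable_torus R.
pose f (z : R * R) := (5 * (`|u z.1| * poisson e (x - z.1) *
   (`|u z.2| * poisson e (z.1 - z.2))))%:E.
have p0 y : 0 <= poisson e y by exact/ltW/poisson_gt0.
have f0 z : (0 <= f z)%E by rewrite lee_fin !mulr_ge0.
have mf : measurable_fun [set: R * R] f.
  apply/measurable_EFinP; apply: measurable_funM => //; apply: measurable_funM; last first.
    by apply/measurable_EFinP; exact: measurable_poisson_conv_kernel.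
  apply: measurable_funM; first exact: (measurableT_comp mn measurable_fst).
  exact: (measurableT_comp (measurable_poisson_sub x e0) measurable_fst).
have mf' : measurable_fun [set: R * R] (fun z => f (z.2, z.1)).
  exact: (measurableT_comp mf (measurable_fun_pair measurable_snd measurable_fst)).
have mf1 t : measurable_fun (torus R) (fun s => f (t, s)).
  exact: (measurable_funTS (measurableT_comp mf (pair1_measurable t))).
have mf2 t : measurable_fun (torus R) (fun s => f (s, t)).
  exact: (measurable_funTS (measurableT_comp mf (pair2_measurable t))).
have mF := measurable_funTS (D := torus R) (measurable_lint mT mf f0).
have mF' := measurable_funTS (D := torus R) (measurable_lint mT mf' (fun z => f0 (z.2, z.1))).
have mQ : measurable_fun [set: R] (fun t => conjugate_poisson e (x - t)).
  apply: measurable_funM; last exact: measurable_poisson_sub.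
  exact: measurable_sinM.
have mh : measurable_fun [set: R] (fun t => `|h t|).
  by rewrite hE; apply: measurableT_comp => //; exact: measurable_funM.
have mhh : measurable_fun [set: R * R]
    (fun z => (`|h z.1| * `|h z.2| * (10 * poisson e (z.2 - z.1)))%:E).
  apply/measurable_EFinP; apply: measurable_funM.
    apply: measurable_funM; first exact: (measurableT_comp mh measurable_fst).
    exact: (measurableT_comp mh measurable_snd).
  apply: measurable_funM => //.
  apply: (measurableT_comp (measurable_poisson e0)).
  exact: (measurable_funB measurable_snd measurable_fst).
have hh0 z : (0 <= (`|h z.1| * `|h z.2| * (10 * poisson e (z.2 - z.1)))%:E)%E.
  by rewrite lee_fin !mulr_ge0.
apply: (@le_trans _ _ (\int[mu]_(t in torus R) (\int[mu]_(s in torus R) f (t, s) +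
    \int[mu]_(s in torus R) f (s, t)))%E).
  apply: le_lint => //.
  - by move=> t _; apply: integral_ge0 => s _; exact: (hh0 (t, s)).
  - exact: (measurable_funTS (measurable_lint mT mhh hh0)).
  - exact: emeasurable_funD.
  move=> t _; rewrite -lintD//.
  apply: le_lint => //.
  - by move=> s _; exact: (hh0 (t, s)).
  - exact: (measurable_funTS (measurableT_comp mhh (pair1_measurable t))).
  - exact: emeasurable_funD.
  move=> s _; rewrite -EFinD lee_fin hE /= (normrM (u t)) (normrM (u s)).
  rewrite (poissonC e t s).
  have := mul_abs_conjugate_poisson_le (x - t) (x - s) e0.
  move=> qk.
  have c0 : 0 <= `|u t| * `|u s| * (10 * poisson e (s - t)) by rewrite !mulr_ge0.
  have := ler_wpM2l c0 qk.
  by lra.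
rewrite lintD//; last 2 first.
- by move=> t _; apply: integral_ge0 => s _; exact: f0.
- by move=> t _; apply: integral_ge0 => s _; exact: f0.
rewrite -(lint_swap mT mf f0).
rewrite (_ : \int[mu]_(t in torus R) \int[mu]_(s in torus R) f (t, s) =
   5%:E * \int[mu]_(t in torus R)
      ((`|u t| * poisson e (x - t))%:E * poisson_conv u e t))%E.
  rewrite -ge0_muleDl ?lee_fin//.
  by rewrite -EFinD -natrD.
have mk : measurable_fun (torus R) (fun t => (`|u t| * poisson e (x - t))%:E).
  apply: measurable_funTS; apply/measurable_EFinP; apply: measurable_funM => //.
  exact: measurable_poisson_sub.
have pc0 t := poisson_conv_ge0 t e0.
rewrite -lintZl//; last 2 first.
- by move=> t _; rewrite mule_ge0// lee_fin mulr_ge0.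
- apply: emeasurable_funM => //.
  exact: measurable_funTS (measurable_poisson_conv e0).
apply: eq_integral => t _.
rewrite muleA -EFinM -lintZl//.
- by apply: eq_integral => s _; rewrite -EFinM /f/=; congr EFin; ring.
- by rewrite !mulr_ge0.
- by move=> s _; rewrite lee_fin mulr_ge0.
- apply: measurable_funTS; apply/measurable_EFinP; apply: measurable_funM => //.
  exact: measurable_poisson_sub.
Qed.

Lemma near_part_le (e x c : R) (g : R -> R) : 0 < e -> 0 <= c ->
  measurable_fun [set: R] g -> (forall t, `|g t| <= c) ->
  (((\int[mu]_(t in torus R) (u t * (g t * poisson e (x - t)))) ^+ 2)%:E <=
    (c ^+ 2)%:E * (poisson_conv u e x * poisson_conv u e x))%E.
Proof.
move=> e0 c0 mg gc.
have mk := measurable_poisson_sub x e0.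
have p0 t : 0 <= poisson e (x - t) by exact/ltW/poisson_gt0.
have ig : tintegrable (fun t => u t * (g t * poisson e (x - t))).
  apply: (tintegrableM (M := c * (e ^+ 2)^-1)) => //; first exact: measurable_funM.
  by move=> t; rewrite normrM ler_pM// (ger0_norm (p0 t)) poisson_le.
set I := \int[mu]_(t in torus R) _.
have Ic : (`|I|%:E <= c%:E * poisson_conv u e x)%E.
  apply: (le_trans (tintegral_abs_le ig)).
  have mT := @measurable_torus R.
  have mk' : measurable_fun (torus R) (fun t => (`|u t| * poisson e (x - t))%:E).
    by apply: measurable_funTS; apply/measurable_EFinP; exact: measurable_funM.
  rewrite -lintZl//; last by move=> t _; rewrite lee_fin mulr_ge0.
  apply: le_lint => //.
  - apply/measurable_EFinP; apply: measurableT_comp => //.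
    exact: (tintegrable_measurable ig).
  - exact: measurable_funeM.
  - move=> t _; rewrite -EFinM lee_fin !normrM (ger0_norm (p0 t)).
    by rewrite mulrCA ler_wpM2r// mulr_ge0.
rewrite -[I ^+ 2]real_normK ?num_real// expr2 EFinM.
have I0 : (0 <= `|I|%:E)%E by rewrite lee_fin.
apply: (le_trans (lee_pmul I0 I0 Ic Ic)).
by rewrite muleACA -EFinM -expr2.
Qed.

(** By [dirichlet_split], the square of the convolution is at most 2 F + 2 r^2. For n <= N, (2n + 1)
    e^2 <= 3 e, so r^2 <= 9 e^2 P_e^2, whence 18. The sum of F over n is at most e times the double
    sum over pairs, itself controlled by 10 times the far integral; averaging brings a second e,
    whence 20 e^2. *)
Lemma mean_sqr_dirichlet_conv_le (N : nat) (e x : R) : (0 < N)%N ->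
  e = N%:R^-1 ->
  ((N%:R^-1 * \sum_(1 <= n < N.+1) dirichlet_conv u n x ^+ 2)%:E <=
   (18 * e ^+ 2)%:E * (poisson_conv u e x * poisson_conv u e x) +
   (20 * e ^+ 2)%:E * \int[mu]_(t in torus R)
      ((`|u t| * poisson e (x - t))%:E * poisson_conv u e t))%E.
Proof.
move=> N0 eN.
have n0 : 0 < N%:R :> R by rewrite ltr0n.
have e0 : 0 < e by rewrite eN invr_gt0.
pose h t := u t * conjugate_poisson e (x - t).
have mQ : measurable_fun [set: R] (fun t => conjugate_poisson e (x - t)).
  apply: measurable_funM; last exact: measurable_poisson_sub.
  exact: measurable_sinM.
have ih : tintegrable h.
  by apply: (tintegrableM (M := (e ^+ 2)^-1)) => // t; exact: abs_conjugate_poisson_le.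
have mh : measurable_fun [set: R] h by exact: measurable_funM.
pose F (m : R) := (\int[mu]_(t in torus R) (h t * cos (m * pi * (x - t)))) ^+ 2 +
  (\int[mu]_(t in torus R) (h t * sin (m * pi * (x - t)))) ^+ 2.
pose r n := \int[mu]_(t in torus R)
   (u t * (dirichlet n (x - t) * e ^+ 2 * poisson e (x - t))).
have F0 m : 0 <= F m by rewrite addr_ge0 ?sqr_ge0.
have mD n : measurable_fun [set: R] (fun t => dirichlet n (x - t) * e ^+ 2).
  by apply: measurable_funM => //; exact: measurable_dirichlet.
have De n t : `|dirichlet n (x - t) * e ^+ 2| <= (2 * n%:R + 1) * e ^+ 2.
  by rewrite normrM (ger0_norm (sqr_ge0 e)) ler_wpM2r ?sqr_ge0// abs_dirichlet_le.
(* [F (2 n + 1)] has an extra cosine part, added so that it becomes a quadratic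
   form in [h] with kernel [cos ((2 n + 1) pi (s - t))]. *)
have splitD n : dirichlet_conv u n x ^+ 2 <= 2 * F (2 * n%:R + 1) + 2 * r n ^+ 2.
  have -> : dirichlet_conv u n x =
      \int[mu]_(t in torus R) (h t * sin ((2 * n%:R + 1) * pi * (x - t))) + r n.
    rewrite /r -tintegralD; last 2 first.
    - exact: tintegrable_sin.
    - apply: (tintegrableM (M := (2 * n%:R + 1) * e ^+ 2 * (e ^+ 2)^-1)) => //.
        by apply: measurable_funM => //; exact: measurable_poisson_sub.
      move=> t; rewrite normrM ler_pM//.
      by rewrite (ger0_norm (ltW (poisson_gt0 _ e0))) poisson_le.
    apply: eq_Rintegral => t _; rewrite [in LHS](dirichlet_split n (x - t) e0) /h.
    by ring.
  rewrite /F; set a := \int[mu]_(t in torus R) _; set b := r n.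
  set d := \int[mu]_(t in torus R) _.
  by have := sqr_ge0 (a - b); have := sqr_ge0 d; nra.
have rle n : (n <= N)%N -> (0 < n)%N ->
    ((r n ^+ 2)%:E <= (9 * e ^+ 2)%:E * (poisson_conv u e x * poisson_conv u e x))%E.
  move=> nN n1; have c0 : 0 <= (2 * n%:R + 1) * e ^+ 2 :> R.
    by rewrite mulr_ge0 ?sqr_ge0// addr_ge0// mulr_ge0.
  apply: (le_trans (near_part_le x e0 c0 (mD n) (De n))).
  rewrite lee_wpmul2r//; first by rewrite mule_ge0// poisson_conv_ge0.
  rewrite lee_fin.
  have -> : 9 * e ^+ 2 = (3 * e) ^+ 2 by ring.
  rewrite ler_sqr ?nnegrE//; last by rewrite mulr_ge0// ltW.
  rewrite expr2 mulrA ler_pM2r// eN ler_pdivrMr//.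
  have : n%:R <= N%:R :> R by rewrite ler_nat.
  have : 1 <= N%:R :> R by rewrite ler1n.
  by lra.
have mB : measurable_fun [set: R] (fun y : R => 10 * poisson e y).
  by apply: measurable_funM => //; exact: measurable_poisson.
pose w (p : 'I_N.*2 * 'I_N.*2) : R := (2 * (p.1%:R - p.2%:R) + 1) * pi.
have hB y : `|\sum_p cos (w p * y)| <= 10 * poisson e y.
  have := sum_cos_odd_le y N0; rewrite -eN; apply: le_trans.
  rewrite pair_bigA/= le_eqVlt; apply/orP; left; apply/eqP; congr (`|_|).
  by apply: eq_bigr => p _; rewrite /w mulrA.
have far := le_trans (sum_sqr_trig_integrals_le x ih mh mB hB) (far_part_le e0 (erefl h)).
set Pf := (\int[mu]_(t in torus R)
  ((`|u t| * poisson e (x - t))%:E * poisson_conv u e t))%E in far *.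
set PP := (poisson_conv u e x * poisson_conv u e x)%E in rle *.
have sumF : ((\sum_(1 <= n < N.+1) F (2 * n%:R + 1))%:E <= (10 * e)%:E * Pf)%E.
  have -> : \sum_(1 <= n < N.+1) F (2 * n%:R + 1) =
      e * (N%:R * \sum_(1 <= n < N.+1) F (2 * n%:R + 1)).
    by rewrite mulrA eN mulVf ?mul1r// gt_eqF.
  rewrite mulrC [in leRHS]EFinM [(10%:E * _)%E]muleC -muleA [leLHS]EFinM muleC.
  rewrite lee_wpmul2l//; first by rewrite lee_fin ltW.
  apply: le_trans far; rewrite lee_fin (le_trans (sum_odd_freq_le N F0))//.
  by rewrite pair_bigA/=.
apply: (@le_trans _ _ ((N%:R^-1 * \sum_(1 <= n < N.+1)
    (2 * F (2 * n%:R + 1) + 2 * r n ^+ 2))%:E)).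
  by rewrite lee_fin ler_wpM2l ?invr_ge0//; apply: ler_sum.
rewrite big_split/= -!mulr_sumr mulrDr -eN EFinD addeC; apply: leeD.
  rewrite mulrCA EFinM.
  have -> : 18 * e ^+ 2 = 2 * (9 * e ^+ 2) by ring.
  rewrite [in leRHS]EFinM -muleA lee_wpmul2l//.
  rewrite EFinM -sumEFin.
  have le_sum : (\sum_(1 <= i < N.+1) (r i ^+ 2)%:E <=
      \sum_(1 <= i < N.+1) (9 * e ^+ 2)%:E * PP)%E.
    rewrite big_nat [leRHS]big_nat; apply: lee_sum => n /andP[n1 nN].
    exact: rle.
  have e0' : (0 <= e%:E)%E by rewrite lee_fin ltW.
  apply: (le_trans (lee_wpmul2l e0' le_sum)).
  rewrite -ge0_sume_distrl; last by move=> n _; rewrite lee_fin mulr_ge0 ?sqr_ge0.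
  rewrite sumEFin sumr_const_nat subSS subn0 muleA -EFinM -(mulr_natl _ N) mulrA.
  by rewrite {1}eN mulVf ?mul1r// gt_eqF.
rewrite mulrCA EFinM.
have -> : 20 * e ^+ 2 = 2 * e * (10 * e) by ring.
rewrite [in leRHS]EFinM [(2 * e)%:E]EFinM -!muleA lee_wpmul2l//.
by rewrite EFinM lee_wpmul2l// lee_fin ltW.
Qed.

End pointwise_bound.

(** * Integration over the complement [G] of the exceptional set *)

Section off_exceptional_set.
Variables (R : realType) (u : R -> R) (G : set R) (a : R).
Local Notation mu := (@lebesgue_measure R).
Local Notation T := (torus R).
Local Notation U := (\int[mu]_(t in T) `|u t|%:E)%E.
Hypotheses (um : measurable_fun [set: R] u) (iu : tintegrable u).
Hypotheses (mG : measurable G) (GT : G `<=` T) (a0 : 0 < a).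
Hypothesis uG : forall x e, G x -> 0 < e -> (poisson_conv u e x <= (a / e)%:E)%E.

Let mT := @measurable_torus R.

Let mn : measurable_fun [set: R] (fun t => `|u t|).
Proof. exact: measurableT_comp. Qed.

Let mU : measurable_fun T (fun t => `|u t|%:E).
Proof. by apply: measurable_funTS; apply/measurable_EFinP. Qed.

Let p0 (e x : R) : 0 < e -> 0 <= poisson e x.
Proof. by move=> e0; exact/ltW/poisson_gt0. Qed.

Lemma lint_poisson_conv_le (e : R) : 0 < e ->
  (\int[mu]_(x in T) poisson_conv u e x <= (12 / e)%:E * U)%E.
Proof.
move=> e0; have c0 : 0 <= 12 / e by rewrite divr_ge0// ltW.
have k0 z : (0 <= (`|u z.2| * poisson e (z.1 - z.2))%:E)%E.
  by rewrite lee_fin mulr_ge0// p0.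
have mk := measurable_poisson_conv_kernel um e0.
rewrite /poisson_conv (lint_swap mT mk k0) -lintZl//.
apply: le_lint => //.
- by move=> t _; apply: integral_ge0 => x _; exact: (k0 (x, t)).
- have mk' : measurable_fun [set: R * R] (fun z => (`|u z.1| * poisson e (z.2 - z.1))%:E).
    exact: (measurableT_comp mk (measurable_fun_pair measurable_snd measurable_fst)).
  exact: (measurable_funTS (measurable_lint mT mk' (fun z => k0 (z.2, z.1)))).
- exact: measurable_funeM.
move=> t tT; rewrite muleC.
have mp : measurable_fun T (fun x => (poisson e (x - t))%:E).
  apply: measurable_funTS; apply/measurable_EFinP.
  by apply: (measurableT_comp (measurable_poisson e0)); exact: measurable_funB.
have pe0 x : T x -> (0 <= (poisson e (x - t))%:E)%E by rewrite lee_fin p0.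
apply: (@le_trans _ _ (`|u t|%:E * \int[mu]_(x in T) (poisson e (x - t))%:E)%E).
  by rewrite -lintZl.
by rewrite lee_wpmul2l// integral_poisson_le.
Qed.

(** On [G] one factor is at most a / e; the other is integrated over the whole torus by
    [lint_poisson_conv_le]. *)
Lemma near_lint_le (e : R) : 0 < e ->
  (\int[mu]_(x in G) (poisson_conv u e x * poisson_conv u e x) <=
   (12 * a / e ^+ 2)%:E * U)%E.
Proof.
move=> e0; have mP := measurable_poisson_conv um e0.
have P0 x := poisson_conv_ge0 u x e0.
have ae0 : 0 <= a / e by rewrite divr_ge0// ltW.
apply: (@le_trans _ _ (\int[mu]_(x in G) ((a / e)%:E * poisson_conv u e x))%E).
  apply: le_lint => //.
  - by move=> x _; rewrite mule_ge0.
  - by apply: emeasurable_funM; exact: measurable_funTS.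
  - by apply: measurable_funeM; exact: measurable_funTS.
  - by move=> x Gx; rewrite lee_wpmul2r// uG.
rewrite lintZl//; last exact: measurable_funTS.
have -> : 12 * a / e ^+ 2 = (a / e) * (12 / e) by field; rewrite gt_eqF.
rewrite (EFinM (a / e)) -muleA lee_wpmul2l//.
apply: le_trans (lint_poisson_conv_le e0).
by apply: ge0_subset_integral => //; exact: measurable_funTS.
Qed.

(** The hypothesis at x holds at every scale, in particular at h = |sin(pi (x - t))| + e. Recentring
    at x costs 3 h^2 / e^2, and (3 h^2 / e^2) (a / h) = 3 a h / e^2. *)
Lemma poisson_conv_recenter_le (e x t : R) : 0 < e -> G x ->
  (poisson_conv u e t <= (3 * a * (`|sin (pi * (x - t))| + e) / e ^+ 2)%:E)%E.
Proof.
move=> e0 Gx; set h := _ + e.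
have h0 : 0 < h by rewrite ltr_wpDl.
have c0 : 0 <= 3 * (h ^+ 2 / e ^+ 2) by rewrite mulr_ge0// divr_ge0 ?sqr_ge0.
have mk (d y : R) : 0 < d -> measurable_fun T (fun s => (`|u s| * poisson d (y - s))%:E).
  move=> d0; apply: measurable_funTS; apply/measurable_EFinP.
  by apply: measurable_funM => //; exact: measurable_poisson_sub.
have k0 (d y s : R) : 0 < d -> (0 <= (`|u s| * poisson d (y - s))%:E)%E.
  by move=> d0; rewrite lee_fin mulr_ge0// p0.
apply: (@le_trans _ _ ((3 * (h ^+ 2 / e ^+ 2))%:E * poisson_conv u h x)%E).
  rewrite /poisson_conv -lintZl//; [|by move=> s _; exact: k0|exact: mk].
  apply: le_lint => //.
  - by move=> s _; exact: k0.
  - exact: mk.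
  - by apply: measurable_funeM; exact: mk.
  - move=> s _; rewrite -EFinM lee_fin mulrCA ler_wpM2l//.
    exact: poisson_recenter.
rewrite (le_trans (lee_wpmul2l _ (uG Gx h0)))//.
rewrite -EFinM lee_fin le_eqVlt; apply/orP; left; apply/eqP; field.
by rewrite !gt_eqF.
Qed.

(* The value [p = P_e(t)] itself measures how far [t] is from [G]: with
   [d = e^2 p / (3 a)], every [x] in [G] has [|sin (pi (x - t))| + e >= d], so the
   kernel of width [e] may be replaced on [G] by the one of width [d]. *)
Lemma poisson_conv_mul_le (e t : R) : 0 < e -> T t ->
  (poisson_conv u e t *
    \int[mu]_(x in T) ((poisson e (x - t))%:E * (\1_G x)%:E) <=
   (108 * a / e ^+ 2)%:E)%E.
Proof.
move=> e0 tT; have P0 := poisson_conv_ge0 u t e0.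
have rhs0 : 0 <= 108 * a / e ^+ 2.
  by rewrite divr_ge0 ?sqr_ge0// mulr_ge0// ltW.
have mp (d : R) : 0 < d -> measurable_fun [set: R] (fun x => (poisson d (x - t))%:E).
  move=> d0; apply/measurable_EFinP.
  by apply: (measurableT_comp (measurable_poisson d0)); exact: measurable_funB.
have mI : measurable_fun [set: R] (fun x => (\1_G x)%:E : \bar R).
  by apply/measurable_EFinP; exact: measurable_indic.
(* If [G] is empty the integral is 0. Otherwise any point of [G] shows, by recentring, that P_e(t)
   is finite. *)
have [[z Gz]|nG] := pselect (exists z, G z); last first.
  rewrite integral0_eq ?mule0 ?lee_fin// => x _.
  rewrite indicE; case: (boolP (x \in G)) => [|_]; last by rewrite mule0.
  by rewrite inE => Gx; exfalso; apply: nG; exists x.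
have Pfin : poisson_conv u e t \is a fin_num.
  rewrite ge0_fin_numE//; exact: (le_lt_trans (poisson_conv_recenter_le t e0 Gz) (ltry _)).
have [P_0|Pn0] := eqVneq (poisson_conv u e t) 0%E.
  by rewrite P_0 mul0e lee_fin.
pose p := fine (poisson_conv u e t).
have pE : poisson_conv u e t = p%:E by rewrite fineK.
have pp : 0 < p by rewrite -lte_fin -pE lt0e Pn0.
pose d := e ^+ 2 * p / (3 * a).
have d0 : 0 < d by rewrite divr_gt0 ?mulr_gt0 ?exprn_gt0.
have dle x : G x -> d <= `|sin (pi * (x - t))| + e.
  move=> Gx; have := poisson_conv_recenter_le t e0 Gx.
  rewrite pE lee_fin ler_pdivlMr ?exprn_gt0// /d ler_pdivrMr ?mulr_gt0//.
  by lra.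
(* From d <= s + e follows d^2 <= 2 s^2 + 2 e^2, so s^2 + d^2 <= 3 (s^2 + e^2). *)
have kle x : G x -> poisson e (x - t) <= 3 * poisson d (x - t).
  move=> Gx; have := dle x Gx; rewrite /poisson.
  have := poisson_den_gt0 (x - t) e0; have := poisson_den_gt0 (x - t) d0.
  rewrite -[sin _ ^+ 2]real_normK ?num_real//.
  have : 0 <= `|sin (pi * (x - t))| by [].
  move: `|_| => s s0 Dd De ds.
  rewrite -[leLHS]mul1r ler_pdivrMr// mulrAC ler_pdivlMr// mul1r.
  have : d ^+ 2 <= (s + e) ^+ 2.
    by rewrite ler_sqr ?nnegrE// ?ltW// ltr_wpDl.
  by have := sqr_ge0 (s - e); nra.
rewrite pE.
(* By the choice of d, p cancels: 36 p / d = 108 a / e^2. *)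
apply: (@le_trans _ _ (p%:E * (3 * (12 / d))%:E)%E); last first.
  rewrite -EFinM lee_fin /d le_eqVlt; apply/orP; left; apply/eqP; field.
  by rewrite !gt_eqF.
rewrite lee_wpmul2l//; first by rewrite lee_fin ltW.
apply: (@le_trans _ _ (\int[mu]_(x in T) (3%:E * (poisson d (x - t))%:E))%E).
  apply: le_lint => //.
  - by move=> x _; rewrite mule_ge0// lee_fin// p0.
  - by apply: measurable_funTS; apply: emeasurable_funM => //; exact: mp.
  - by apply: measurable_funTS; apply: measurable_funeM; exact: mp.
  move=> x _; rewrite indicE; case: (boolP (x \in G)) => [|_].
    by rewrite inE => Gx; rewrite mule1 -EFinM lee_fin kle.
  by rewrite mule0 mule_ge0// lee_fin p0.
rewrite lintZl//; last 2 first.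
- by move=> x _; rewrite lee_fin p0.
- by apply: measurable_funTS; exact: mp.
by rewrite EFinM lee_wpmul2l// integral_poisson_le.
Qed.

(** By Tonelli, x is integrated first with t fixed: [poisson_conv_mul_le] absorbs P_e(t) and the
    kernel, leaving |u(t)|. *)
Lemma far_lint_le (e : R) : 0 < e ->
  (\int[mu]_(x in G) \int[mu]_(t in T)
     ((`|u t| * poisson e (x - t))%:E * poisson_conv u e t) <=
   (108 * a / e ^+ 2)%:E * U)%E.
Proof.
move=> e0; have mP := measurable_poisson_conv um e0.
have P0 x := poisson_conv_ge0 u x e0.
have mk := measurable_poisson_conv_kernel um e0.
have rhs0 : 0 <= 108 * a / e ^+ 2.
  by rewrite divr_ge0 ?sqr_ge0// mulr_ge0// ltW.
have mI : measurable_fun [set: R] (fun x => (\1_G x)%:E : \bar R).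
  by apply/measurable_EFinP; exact: measurable_indic.
(* The indicator of [G] turns both integrals into integrals over the torus, the setting of
   [lint_swap]. *)
pose f (z : R * R) := ((`|u z.2| * poisson e (z.1 - z.2))%:E *
  poisson_conv u e z.2 * (\1_G z.1)%:E)%E.
have f0 z : (0 <= f z)%E.
  by rewrite !mule_ge0// lee_fin// mulr_ge0// p0.
have mf : measurable_fun [set: R * R] f.
  apply: emeasurable_funM; last exact: (measurableT_comp mI measurable_fst).
  by apply: emeasurable_funM => //; exact: (measurableT_comp mP measurable_snd).
have mf' : measurable_fun [set: R * R] (fun z => f (z.2, z.1)).
  exact: (measurableT_comp mf (measurable_fun_pair measurable_snd measurable_fst)).
have mkx x : measurable_fun T
    (fun t => ((`|u t| * poisson e (x - t))%:E * poisson_conv u e t)%E).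
  apply: measurable_funTS; apply: emeasurable_funM => //.
  exact: (measurableT_comp mk (pair1_measurable x)).
rewrite (lint_subset_indic _ GT).
rewrite (_ : (\int[mu]_(x in T) _)%E =
  (\int[mu]_(x in T) \int[mu]_(t in T) f (x, t))%E); last first.
  apply: eq_integral => x _; rewrite muleC -lintZl//.
    by apply: eq_integral => t _; rewrite /f/= muleC.
  by move=> t _; rewrite mule_ge0// lee_fin mulr_ge0// p0.
rewrite (lint_swap mT mf f0) -lintZl//.
apply: le_lint => //.
- by move=> t _; apply: integral_ge0 => x _; exact: f0.
- exact: (measurable_funTS (measurable_lint mT mf' (fun z => f0 (z.2, z.1)))).
- exact: measurable_funeM.
move=> t tT.
have mp : measurable_fun T (fun x => ((poisson e (x - t))%:E * (\1_G x)%:E)%E).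
  apply: measurable_funTS; apply: emeasurable_funM => //; apply/measurable_EFinP.
  by apply: (measurableT_comp (measurable_poisson e0)); exact: measurable_funB.
have pp0 x : T x -> (0 <= (poisson e (x - t))%:E * (\1_G x)%:E)%E.
  by move=> _; rewrite mule_ge0// lee_fin// p0.
rewrite [leRHS]muleC.
apply: (le_trans _ (lee_wpmul2l _ (poisson_conv_mul_le e0 tT))); last by rewrite lee_fin.
rewrite muleA; set q := (`|u t|%:E * _)%E.
have q0 : (0 <= q)%E by rewrite mule_ge0.
rewrite -lintZl_ereal//.
apply: (le_lint mT).
- by move=> x _; exact: (f0 (x, t)).
- exact: (measurable_funTS (measurableT_comp mf (pair2_measurable t))).
- exact: measurable_funeM.
by move=> x _; rewrite /f/= /q EFinM [X in (X * _ <= _)%E]muleAC muleA.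
Qed.

End off_exceptional_set.

(** * The estimate for real functions *)

Section real_strong_summability.
Variable R : realType.
Local Notation mu := (@lebesgue_measure R).
Implicit Types (u v : R -> R) (n N : nat).

(** Separates x from t: the convolution becomes a trigonometric polynomial in x, hence measurable,
    and can be matched with Fourier coefficients. *)
Lemma tintegral_cosE u (w x : R) : tintegrable u ->
  \int[mu]_(t in torus R) (u t * cos (w * (x - t))) =
  cos (w * x) * \int[mu]_(t in torus R) (u t * cos (w * (0 - t))) -
  sin (w * x) * \int[mu]_(t in torus R) (u t * sin (w * (0 - t))).
Proof.
move=> iu; have ic := tintegrable_cos w 0 iu; have isn := tintegrable_sin w 0 iu.
rewrite -mulNr ![_ * Rintegral _ _ _]mulrC -!tintegralZr// -tintegralD.
- apply: eq_Rintegral => t _.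
  have -> : w * (x - t) = w * x + w * (0 - t) by ring.
  by rewrite cosD; ring.
- exact: tintegrableMr.
- exact: tintegrableMr.
Qed.

Lemma tintegral_sinE u (w x : R) : tintegrable u ->
  \int[mu]_(t in torus R) (u t * sin (w * (x - t))) =
  sin (w * x) * \int[mu]_(t in torus R) (u t * cos (w * (0 - t))) +
  cos (w * x) * \int[mu]_(t in torus R) (u t * sin (w * (0 - t))).
Proof.
move=> iu; have ic := tintegrable_cos w 0 iu; have isn := tintegrable_sin w 0 iu.
rewrite ![_ * Rintegral _ _ _]mulrC -!tintegralZr// -tintegralD.
- apply: eq_Rintegral => t _.
  have -> : w * (x - t) = w * x + w * (0 - t) by ring.
  by rewrite sinD; ring.
- exact: tintegrableMr.
- exact: tintegrableMr.
Qed.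

Lemma dirichlet_convE u n (x : R) : tintegrable u ->
  dirichlet_conv u n x = \sum_(k < n.*2.+1)
    \int[mu]_(t in torus R) (u t * cos (2 * pi * (k%:Z - n%:Z)%:~R * (x - t))).
Proof.
move=> iu; rewrite -tintegral_sum; last by move=> k; exact: tintegrable_cos.
by apply: eq_Rintegral => t _; rewrite mulr_sumr.
Qed.

Lemma measurable_dirichlet_conv u n : tintegrable u ->
  measurable_fun [set: R] (dirichlet_conv u n).
Proof.
move=> iu; rewrite (_ : dirichlet_conv u n = fun x => \sum_(k < n.*2.+1)
    (cos (2 * pi * (k%:Z - n%:Z)%:~R * x) *
       \int[mu]_(t in torus R) (u t * cos (2 * pi * (k%:Z - n%:Z)%:~R * (0 - t))) -
     sin (2 * pi * (k%:Z - n%:Z)%:~R * x) *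
       \int[mu]_(t in torus R) (u t * sin (2 * pi * (k%:Z - n%:Z)%:~R * (0 - t))))); last first.
  apply/funext => x; rewrite dirichlet_convE//; apply: eq_bigr => k _.
  exact: tintegral_cosE.
apply: measurable_sum => k; apply: measurable_funB; apply: measurable_funM => //.
  apply: (measurableT_comp (f := cos)); last exact: measurable_funM.
  exact: (continuous_measurable_fun (@continuous_cos R)).
apply: (measurableT_comp (f := sin)); last exact: measurable_funM.
exact: (continuous_measurable_fun (@continuous_sin R)).
Qed.

Lemma sum_tintegral_sin u n (x : R) : tintegrable u ->
  \sum_(k < n.*2.+1)
    \int[mu]_(t in torus R) (u t * sin (2 * pi * (k%:Z - n%:Z)%:~R * (x - t))) = 0.
Proof.
move=> iu; rewrite -tintegral_sum; last by move=> k; exact: tintegrable_sin.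
under eq_Rintegral do rewrite -mulr_sumr sum_sin_odd mulr0.
by rewrite Rintegral_cst ?mul0r//; exact: measurable_torus.
Qed.

Lemma lint_mean (D : set R) N (g : nat -> R -> R) : measurable D ->
  (forall n, measurable_fun [set: R] (g n)) -> (forall n x, 0 <= g n x) ->
  ((N%:R^-1)%:E * \sum_(1 <= n < N.+1) \int[mu]_(x in D) (g n x)%:E =
   \int[mu]_(x in D) (N%:R^-1 * \sum_(1 <= n < N.+1) g n x)%:E)%E.
Proof.
move=> mD mg g0.
have mgE n : measurable_fun D (fun x => (g n x)%:E).
  by apply: measurable_funTS; apply/measurable_EFinP.
under eq_integral do rewrite EFinM -sumEFin.
rewrite lintZl//.
- by rewrite -ge0_integral_sum// => n x _; rewrite lee_fin.
- by move=> x _; rewrite sume_ge0// => n _; rewrite lee_fin.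
- by apply: emeasurable_sum.
Qed.

(* 2376 = 18 * 12 + 20 * 108 collects the near and far parts, and 270 is the
   constant of [exceptional_set]; products keep the numerals, which are unary,
   small. *)
Lemma real_strong_summability u (lambda : R) : tintegrable u -> 0 < lambda ->
  exists E : set R, [/\ measurable E, E `<=` torus R,
    (mu E <= (1 / lambda)%:E)%E &
    forall N, (0 < N)%N ->
      (\int[mu]_(x in torus R `\` E)
         (N%:R^-1 * \sum_(1 <= n < N.+1) dirichlet_conv u n x ^+ 2)%:E
       <= (2376 * 270 * lambda * (\int[mu]_(t in torus R) `|u t|) ^+ 2)%:E)%E].
Proof.
move=> iu l0; have mT := @measurable_torus R.
(* The preceding bounds assume measurability on all of [R], whereas [u] is only known to be
   measurable on the torus; the convolutions see no difference. *)
pose v := u \_ (torus R).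
have vu t : torus R t -> v t = u t by move=> tT; rewrite /v patchE mem_set.
have iv : tintegrable v.
  apply: (@eq_integrable _ _ _ mu _ mT (EFin \o u)) => //.
  by move=> t; rewrite inE => tT; rewrite /= vu.
have mv : measurable_fun [set: R] v.
  apply/(measurable_restrictT _ _).1 => //; exact: tintegrable_measurable.
set I := \int[mu]_(t in torus R) `|u t|.
have I0 : 0 <= I by exact: Rintegral_ge0.
have IE : (\int[mu]_(t in torus R) `|v t|%:E = I%:E)%E.
  rewrite /I /Rintegral fineK.
    by apply: eq_integral => t; rewrite inE => tT; rewrite vu.
  by have /integrable_abse := iu; exact: integrable_fin_num.
have convE n x : dirichlet_conv u n x = dirichlet_conv v n x.
  by apply: eq_Rintegral => t; rewrite inE => tT; rewrite vu.
(* When [I = 0] any positive level will do. *)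
pose a := if I == 0 then 1 else 270 * lambda * I.
have a0 : 0 < a.
  rewrite /a; case: eqP => [_|/eqP In0]; first exact: ltr01.
  apply: mulr_gt0; last by rewrite lt0r In0.
  by apply: mulr_gt0; [lra|exact: l0].
have aI : a * I = 270 * lambda * I ^+ 2.
  by rewrite /a; case: eqP => [->|_]; ring.
have [E [mE ET muE vE]] := exceptional_set iv a0.
exists E; split => //.
  (* The level [a] is chosen so that (270 / a) I = 1 / lambda when I is nonzero. *)
  apply: (le_trans muE); rewrite IE -EFinM lee_fin /a.
  case: eqP => [->|/eqP In0]; first by rewrite mulr0 divr_ge0// ltW.
  rewrite le_eqVlt; apply/orP; left; apply/eqP; field.
  by rewrite In0 gt_eqF.
move=> N N0.
have mG : measurable (torus R `\` E : set R) by exact: measurableD.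
have GT : torus R `\` E `<=` torus R by exact: subDsetl.
have n0 : 0 < N%:R :> R by rewrite ltr0n.
pose e : R := N%:R^-1; have e0 : 0 < e by rewrite invr_gt0.
under eq_integral do under eq_bigr do rewrite convE.
have mP := measurable_poisson_conv mv e0.
have P0 x := poisson_conv_ge0 v x e0.
have c18 : 0 <= 18 * e ^+ 2 by rewrite mulr_ge0// sqr_ge0.
have c20 : 0 <= 20 * e ^+ 2 by rewrite mulr_ge0// sqr_ge0.
have mk := measurable_poisson_conv_kernel mv e0.
have mPP : measurable_fun (torus R `\` E : set R)
    (fun x => (poisson_conv v e x * poisson_conv v e x)%E).
  by apply: measurable_funTS; exact: emeasurable_funM.
pose f (z : R * R) := ((`|v z.2| * poisson e (z.1 - z.2))%:E * poisson_conv v e z.2)%E.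
have f0 z : (0 <= f z)%E.
  by rewrite mule_ge0// lee_fin mulr_ge0// ltW// poisson_gt0.
have mf : measurable_fun [set: R * R] f.
  by apply: emeasurable_funM => //; exact: (measurableT_comp mP measurable_snd).
have mF := measurable_funTS (D := torus R `\` E) (measurable_lint mT mf f0).
have F0 x : (0 <= \int[mu]_(t in torus R) f (x, t))%E.
  by apply: integral_ge0 => t _; exact: f0.
have PP0 x : (0 <= poisson_conv v e x * poisson_conv v e x)%E by rewrite mule_ge0.
have mD n : measurable_fun [set: R] (fun x => dirichlet_conv v n x ^+ 2).
  by apply: measurable_funX; exact: measurable_dirichlet_conv.
apply: (@le_trans _ _ (\int[mu]_(x in torus R `\` E)
   ((18 * e ^+ 2)%:E * (poisson_conv v e x * poisson_conv v e x) +
    (20 * e ^+ 2)%:E * \int[mu]_(t in torus R) f (x, t)))%E).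
  apply: (le_lint mG).
  - move=> x _; rewrite lee_fin mulr_ge0 ?invr_ge0// sumr_ge0// => n _.
    exact: sqr_ge0.
  - apply: measurable_funTS; apply/measurable_EFinP; apply: measurable_funM => //.
    exact: measurable_sum.
  - by apply: emeasurable_funD; exact: measurable_funeM.
  - by move=> x _; exact: (mean_sqr_dirichlet_conv_le mv iv x N0 (erefl e)).
rewrite (lintD mG); last 4 first.
- by move=> x _; rewrite mule_ge0.
- exact: measurable_funeM.
- by move=> x _; rewrite mule_ge0.
- exact: measurable_funeM.
rewrite (lintZl mG c18 (fun x _ => PP0 x) mPP) (lintZl mG c20 (fun x _ => F0 x) mF).
have near := near_lint_le mv mG GT a0 vE e0.
have far := far_lint_le mv mG GT a0 vE e0.
rewrite IE -EFinM in near; rewrite IE -EFinM in far.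
have c18' : (0 <= (18 * e ^+ 2)%:E)%E by rewrite lee_fin.
have c20' : (0 <= (20 * e ^+ 2)%:E)%E by rewrite lee_fin.
apply: (le_trans (leeD (lee_wpmul2l c18' near) (lee_wpmul2l c20' far))).
rewrite -!EFinM -EFinD lee_fin.
have -> : 2376 * 270 * lambda * I ^+ 2 = 2376 * (a * I) by rewrite aI; ring.
rewrite le_eqVlt; apply/orP; left; apply/eqP; field.
by rewrite gt_eqF.
Qed.

End real_strong_summability.

(** * Reduction of complex partial sums to real convolutions *)

Section fourier_sum_parts.
Variable R : realType.
Local Notation mu := (@lebesgue_measure R).
Local Notation Re := complex.Re.
Local Notation Im := complex.Im.

(** Writing [0 - t] matches the right-hand sides of [tintegral_cosE] and [tintegral_sinE], which
    reassemble these terms into convolutions. *)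
Lemma fourier_termE (f : R -> R[i]) (j : int) (x : R) : cintegrable f ->
  let w := 2 * pi * j%:~R in
  let a := \int[mu]_(t in torus R) (Re (f t) * cos (w * (0 - t))) in
  let b := \int[mu]_(t in torus R) (Re (f t) * sin (w * (0 - t))) in
  let c := \int[mu]_(t in torus R) (Im (f t) * cos (w * (0 - t))) in
  let d := \int[mu]_(t in torus R) (Im (f t) * sin (w * (0 - t))) in
  fourier_coef f j * echar j x =
  Complex ((a - d) * cos (w * x) - (b + c) * sin (w * x))
          ((a - d) * sin (w * x) + (b + c) * cos (w * x)).
Proof.
move=> [iu iv] w a b c d.
have wN t : 2 * pi * (- j)%:~R * t = w * (0 - t) by rewrite /w rmorphN/=; ring.
have -> : fourier_coef f j = Complex (a - d) (b + c).
  rewrite /fourier_coef /cintegral; congr Complex.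
    transitivity (\int[mu]_(t in torus R)
      (Re (f t) * cos (w * (0 - t)) + Im (f t) * sin (w * (0 - t)) * -1)).
      apply: eq_Rintegral => t _; rewrite /echar wN; case: (f t) => p q /=.
      by ring.
    rewrite tintegralD; last 2 first.
    - exact: tintegrable_cos.
    - by apply: tintegrableMr; exact: tintegrable_sin.
    by rewrite tintegralZr ?mulrN1//; exact: tintegrable_sin.
  rewrite -tintegralD; last 2 first.
  - exact: tintegrable_sin.
  - exact: tintegrable_cos.
  by apply: eq_Rintegral => t _; rewrite /echar wN; case: (f t) => p q /=.
by rewrite /echar -/w; congr Complex; rewrite /=; ring.
Qed.

Lemma Re_fourier_sum (f : R -> R[i]) n (x : R) : cintegrable f ->
  Re (fourier_sum f n x) = dirichlet_conv (fun t => Re (f t)) n x.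
Proof.
move=> If; have [iu iv] := If.
rewrite /fourier_sum; under eq_bigr do rewrite fourier_termE//.
rewrite raddf_sum/=.
rewrite dirichlet_convE//.
(* The contribution of [Im f] consists of sine integrals that cancel only after summation, so this
   zero is subtracted on the right to compare termwise. *)
rewrite -[RHS]subr0 -[X in _ = _ - X](sum_tintegral_sin n x iv) -sumrB.
apply: eq_bigr => k _.
by rewrite (tintegral_cosE _ x iu) (tintegral_sinE _ x iv); ring.
Qed.

Lemma Im_fourier_sum (f : R -> R[i]) n (x : R) : cintegrable f ->
  Im (fourier_sum f n x) = dirichlet_conv (fun t => Im (f t)) n x.
Proof.
move=> If; have [iu iv] := If.
rewrite /fourier_sum; under eq_bigr do rewrite fourier_termE//.
rewrite raddf_sum/=.
rewrite dirichlet_convE//.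
rewrite -[RHS]addr0 -[X in _ = _ + X](sum_tintegral_sin n x iu) -big_split/=.
apply: eq_bigr => k _.
by rewrite (tintegral_cosE _ x iv) (tintegral_sinE _ x iu); ring.
Qed.

Lemma cabs_sqrE (z : R[i]) : cabs z ^+ 2 = Re z ^+ 2 + Im z ^+ 2.
Proof.
by case: z => a b; rewrite /cabs/= sqr_sqrtr// addr_ge0 ?sqr_ge0.
Qed.

Lemma abs_Re_le_cabs (z : R[i]) : `|Re z| <= cabs z.
Proof.
by case: z => a b; rewrite /cabs/= -sqrtr_sqr ler_wsqrtr// lerDl sqr_ge0.
Qed.

Lemma abs_Im_le_cabs (z : R[i]) : `|Im z| <= cabs z.
Proof.
by case: z => a b; rewrite /cabs/= -sqrtr_sqr ler_wsqrtr// lerDr sqr_ge0.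
Qed.

Lemma cabs_le (z : R[i]) : cabs z <= `|Re z| + `|Im z|.
Proof.
have c0 : 0 <= cabs z by case: z => a b; exact: sqrtr_ge0.
rewrite -ler_sqr ?nnegrE ?addr_ge0// cabs_sqrE sqrrD.
rewrite !real_normK ?num_real// lerD2r lerDl mulrn_wge0// mulr_ge0//.
Qed.

Lemma tintegrable_cabs (f : R -> R[i]) : cintegrable f ->
  tintegrable (fun t => cabs (f t)).
Proof.
move=> [iu iv].
have mT := @measurable_torus R.
apply: (@le_integrable _ _ _ mu _ mT _ (fun t => (`|Re (f t)| + `|Im (f t)|)%:E)).
- apply/measurable_EFinP.
  rewrite (_ : (fun t => cabs (f t)) = fun t => Num.sqrt (Re (f t) ^+ 2 + Im (f t) ^+ 2)).
    have mg : measurable_fun (torus R) (fun t => Re (f t) ^+ 2 + Im (f t) ^+ 2).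
      by apply: measurable_funD; apply: measurable_funX; exact: tintegrable_measurable.
    exact: (measurableT_comp (continuous_measurable_fun (@sqrt_continuous R)) mg).
  by apply/funext => t; case: (f t).
- move=> t _ /=; rewrite lee_fin [leRHS]ger0_norm ?addr_ge0//.
  by rewrite ger0_norm ?cabs_le//; case: (f t) => a b; exact: sqrtr_ge0.
- apply: tintegrableD; exact: integrable_norm.
Qed.

End fourier_sum_parts.

Theorem theorem10 (R : realType) :
  exists2 C : R, 0 < C &
    forall lambda : R, 0 < lambda ->
    forall f : R -> R[i], cintegrable f ->
    exists E : set R,
      [/\ measurable E,
          E `<=` torus R,
          (lebesgue_measure E <= (1 / lambda)%:E)%E &
          (ereal_sup
             [set ((N%:R)^-1%:E *
                   \sum_(1 <= n < N.+1)
                     \int[lebesgue_measure]_(t in torus R `\` E)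
                       (cabs (fourier_sum f n t) ^+ 2)%:E)%E
             | N in [set N : nat | (1 <= N)%N]]
           <= (C * lambda * L1norm f ^+ 2)%:E)%E].
Proof.
(* The factor 4 is 2 for the doubled lambda times 2 for the real and imaginary parts. *)
exists (2376 * 270 * 4).
  by apply: mulr_gt0; [apply: mulr_gt0|]; lra.
move=> lambda l0 f If; have [iu iv] := If.
have mT := @measurable_torus R.
(* Applied with 2 lambda, each part has an exceptional set of measure at most 1 / (2 lambda), and
   their union stays within 1 / lambda. *)
have l20 : 0 < 2 * lambda by rewrite mulr_gt0.
have [E1 [mE1 E1T muE1 bE1]] := real_strong_summability iu l20.
have [E2 [mE2 E2T muE2 bE2]] := real_strong_summability iv l20.
exists (E1 `|` E2); split.
- exact: measurableU.
- by move=> x [/E1T|/E2T].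
- have /le_trans -> // := measureU2 lebesgue_measure mE1 mE2.
  apply: (le_trans (leeD muE1 muE2)).
  rewrite -EFinD lee_fin le_eqVlt; apply/orP; left; apply/eqP; field.
  by rewrite gt_eqF.
apply: ge_ereal_sup => _ [N /= N0 <-].
set G := torus R `\` (E1 `|` E2).
have mG : measurable G by apply: measurableD => //; exact: measurableU.
have G1 : G `<=` torus R `\` E1 by move=> x [xT nE]; split => // xE; apply: nE; left.
have G2 : G `<=` torus R `\` E2 by move=> x [xT nE]; split => // xE; apply: nE; right.
pose F (u : R -> R) (x : R) : \bar R :=
  (N%:R^-1 * \sum_(1 <= n < N.+1) dirichlet_conv u n x ^+ 2)%:E.
have F0 u x : (0 <= F u x)%E.
  by rewrite lee_fin mulr_ge0 ?invr_ge0// sumr_ge0// => n _; exact: sqr_ge0.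
have mD u n : tintegrable u ->
    measurable_fun [set: R] (fun x => dirichlet_conv u n x ^+ 2).
  by move=> iu'; apply: measurable_funX; exact: measurable_dirichlet_conv.
have mF u : tintegrable u -> measurable_fun [set: R] (F u).
  move=> iu'; apply/measurable_EFinP; apply: measurable_funM => //.
  by apply: measurable_sum => n; exact: mD.
have cE n x : cabs (fourier_sum f n x) ^+ 2 =
    dirichlet_conv (fun t => complex.Re (f t)) n x ^+ 2 +
    dirichlet_conv (fun t => complex.Im (f t)) n x ^+ 2.
  by rewrite cabs_sqrE Re_fourier_sum// Im_fourier_sum.
under eq_bigr do under eq_integral do rewrite cE.
rewrite (@lint_mean R G N (fun n x => dirichlet_conv (fun t => complex.Re (f t)) n x ^+ 2 +
    dirichlet_conv (fun t => complex.Im (f t)) n x ^+ 2))//; last 2 first.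
- by move=> n; apply: measurable_funD; exact: mD.
- by move=> n x; rewrite addr_ge0 ?sqr_ge0.
have -> : (\int[lebesgue_measure]_(x in G) (N%:R^-1 * \sum_(1 <= n < N.+1)
     (dirichlet_conv (fun t => complex.Re (f t)) n x ^+ 2 +
      dirichlet_conv (fun t => complex.Im (f t)) n x ^+ 2))%:E =
   \int[lebesgue_measure]_(x in G)
     (F (fun t => complex.Re (f t)) x + F (fun t => complex.Im (f t)) x))%E.
  by apply: eq_integral => x _; rewrite /F -EFinD -mulrDr -big_split.
rewrite lintD//; [|exact: measurable_funTS (mF _ iu)|exact: measurable_funTS (mF _ iv)].
have sub u (E : set R) : measurable E -> tintegrable u -> G `<=` torus R `\` E ->
    (\int[lebesgue_measure]_(x in G) F u x <=
     \int[lebesgue_measure]_(x in torus R `\` E) F u x)%E.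
  move=> mE iu' GE; apply: ge0_subset_integral => //; first exact: measurableD.
  exact: measurable_funTS (mF _ iu').
apply: (le_trans (leeD (le_trans (sub _ _ mE1 iu G1) (bE1 N N0))
                       (le_trans (sub _ _ mE2 iv G2) (bE2 N N0)))).
have ic := tintegrable_cabs If.
(* Both parts of [f] are dominated by |f|, so each squared norm is at most that of [f]. *)
have le_L1 (g : R[i] -> R) : tintegrable (fun t => g (f t)) ->
    (forall z, `|g z| <= cabs z) ->
    (\int[lebesgue_measure]_(t in torus R) `|g (f t)|) ^+ 2 <= L1norm f ^+ 2.
  move=> ig gc; rewrite ler_sqr ?nnegrE; last 2 first.
  - exact: Rintegral_ge0.
  - by apply: Rintegral_ge0 => t _; exact: le_trans (gc _).
  by apply: le_Rintegral => //; exact: integrable_norm.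
have := le_L1 _ iu (@abs_Re_le_cabs R); have := le_L1 _ iv (@abs_Im_le_cabs R).
rewrite -EFinD lee_fin -mulrDr.
move: (L1norm f ^+ 2) => L; move: (_ ^+ 2) => V; move: (_ ^+ 2) => U VL UL.
have -> : 2376 * 270 * 4 * lambda * L = 2376 * 270 * (2 * lambda) * (L + L) by ring.
apply: ler_wpM2l; last by rewrite lerD.
by apply: mulr_ge0; [lra|exact: ltW].
Qed.
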